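(* Let $H$ be a finite connected graph with $v\ge2$ vertices and $e$ edges which is not a tree, let $\widetilde H$ be its $2$-core, with $\widetilde v$ vertices, $\widetilde e$ edges and maximum degree $\widetilde\Delta$, and let $\omega:=v-\widetilde v=e-\widetilde e$. Let $\mathcal G_n$ be the Erdős–Rényi random graph on $[n]$ with edge probability $p_n$, where $(n\log n)^{-1/\widetilde\Delta}\ll p_n\ll1$. Then $$\sup_{S\subseteq[n]}\frac1{n^v}\left|p_n^{-e}\mathcal N_H(S;\mathcal G_n)-(|S|-\widetilde v)_\omega\,p_n^{-\widetilde e}\mathcal N_{\widetilde H}(S;\mathcal G_n)\right|\to0\quad\text{in probability as }n\to\infty.$$
   Context: $[m]:=\{1,\ldots,m\}$; $a_n\ll b_n$ means $a_n/b_n\to0$. The $2$-core of $H$ is the maximal subgraph of $H$ in which all vertices have degree at least $2$. The random graph: $\mathcal G_n(i,j)\sim\mathrm{Ber}(p_n)$ independently for $i<j$, $\mathcal G_n(i,j)=\mathcal G_n(j,i)$, $\mathcal G_n(i,i)=0$. For $S\subseteq[n]$ and a graph $F$, $$\mathcal N_F(S;\mathcal G_n):=\sum_{\varphi:V(F)\hookrightarrow S}\ \prod_{\{a,b\}\in E(F)}\mathcal G_n(\varphi(a),\varphi(b)),$$ the sum being over injective maps $\varphi:V(F)\to S$. $(m)_d:=m(m-1)\cdots(m-d+1)$ and $(m)_0:=1$. *)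

(* Defs.v *)
From HB Require Import structures.
From mathcomp Require Import all_boot all_order all_algebra.
From mathcomp Require Import all_classical all_reals all_analysis.
Set Implicit Arguments.
Unset Strict Implicit.
Unset Printing Implicit Defensive.
Import Order.TTheory GRing.Theory Num.Theory.
Import numFieldNormedType.Exports.
Local Open Scope classical_set_scope.
Local Open Scope ring_scope.

(* A finite simple graph whose vertex set is a subset of the ambient finite
   type [T], so that a graph and its subgraphs inhabit the same type. *)
Record sgraph (T : finType) := SGraph {
  verts : {set T};
  adj : rel T;
  adj_sym : symmetric adj;
  adj_irr : irreflexive adj;
  adj_verts : forall x y, adj x y -> x \in verts }.

Section FiniteGraphs.
Variable T : finType.
Implicit Types F K : sgraph T.

Definition vertex F := {x : T | x \in verts F}.

(* Each unordered edge {a, b} occurs exactly once, oriented along the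
   enumeration of [T]. *)
Definition edges F : {set vertex F * vertex F} :=
  [set ab | adj F (val ab.1) (val ab.2) &&
            (enum_rank (val ab.1) < enum_rank (val ab.2))%N].

Definition deg F (x : T) : nat := #|[set y | adj F x y]|.

Definition max_deg F : nat := \max_(x in verts F) deg F x.

Definition connected_graph F : Prop :=
  verts F != finset.set0 /\
  forall x y, x \in verts F -> y \in verts F -> connect (adj F) x y.

Definition acyclic F : Prop :=
  forall c : seq T, (2 < size c)%N -> ~ ucycle (adj F) c.

Definition is_tree F : Prop := connected_graph F /\ acyclic F.

Definition subgraph K F : Prop :=
  verts K \subset verts F /\ subrel (adj K) (adj F).

Definition min_deg_ge2 K : Prop := forall x, x \in verts K -> (2 <= deg K x)%N.

Definition is_two_core K F : Prop :=
  [/\ subgraph K F, min_deg_ge2 K &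
      forall K', subgraph K' F -> min_deg_ge2 K' -> subgraph K K' ->
                 subgraph K' K].

(* The product evaluates [g] at one ordering of each edge; this is
   immaterial for the symmetric [g] to which it is applied. *)
Definition copies (F : sgraph T) (n : nat) (S : {set 'I_n})
    (g : 'I_n -> 'I_n -> bool) : nat :=
  \sum_(phi : {ffun vertex F -> 'I_n} |
          injectiveb phi && [forall x, phi x \in S])
     \prod_(ab in edges F) g (phi ab.1) (phi ab.2).

End FiniteGraphs.

Section Asymptotics.
Variable R : realType.

(* Over [R], rather than with [^_] on [nat], so that [m] may be negative. *)
Definition falling (m : R) (d : nat) : R := \prod_(k < d) (m - k%:R).

(* The first conjunct makes the quotient meaningful, since x / 0 = 0. *)
Definition much_less (a b : nat -> R) : Prop :=
  (\forall n \near \oo, b n != 0) /\ (a n / b n @[n --> \oo] --> (0 : R)).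

End Asymptotics.

Section Probability.

Definition mutually_independent (R : realType) (d d' : measure_display)
    (Omega : measurableType d) (T' : measurableType d')
    (P : probability Omega R) (I : finType) (X : I -> {RV P >-> T'}) : Prop :=
  forall (J : {set I}) (B : I -> set T'),
    (forall i, i \in J -> measurable (B i)) ->
    P (\bigcap_(i in [set` J]) (X i @^-1` B i)) =
    (\prod_(i in J) P (X i @^-1` B i))%E.

Definition erdos_renyi (R : realType) (d : measure_display)
    (Omega : measurableType d) (P : probability Omega R) (n : nat) (p : R)
    (G : 'I_n -> 'I_n -> {RV P >-> bool}) : Prop :=
  [/\ forall (i j : 'I_n), (i < j)%N ->
        forall B : set bool, distribution P (G i j) B = bernoulli_prob p B,
      mutually_independent
        (fun ij : {ij : 'I_n * 'I_n | (ij.1 < ij.2)%N} =>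
           G (val ij).1 (val ij).2),
      forall i j w, G i j w = G j i w &
      forall i w, G i i w = false].

(* The n-th variable lives on its own probability space. *)
Definition cvg_in_probability0 (R : realType) (d : nat -> measure_display)
    (Omega : forall n, measurableType (d n))
    (P : forall n, probability (Omega n) R)
    (X : forall n, Omega n -> R) : Prop :=
  forall eps : R, 0 < eps ->
    P n [set w | eps < `|X n w|] @[n --> \oo] --> 0%E.

End Probability.

(* Main.v *)
(* Proof idea. H arises from its 2-core by repeatedly attaching a leaf u to a
   vertex x. Summing over the position of u multiplies the contribution of a
   copy by the number of neighbours in S of the image y of x, which is
   p |S| + D_S(y); replacing it by p (|S| - #W), where #W is the number of
   vertices already embedded, costs on average M(y) |D_S(y)|, where M(y) counts
   copies rooted at y. By AM-GM it suffices that, after normalization, the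
   average of M(y)^2 is bounded and that of D_S(y)^2 is small uniformly in S.
   The first holds in expectation: two copies that overlap in a vertex set J
   contribute at most n^(1-|J|) p^(-e(J)) relative to the main term, which is
   bounded because e(J) <= Dt |J| / 2 for J inside the core, and because each
   leaf contributes a factor n p >= 1. The second follows from Chernoff bounds:
   degrees are O(n p), and a union bound over the 4^n pairs (S, signs) controls
   sum_y |D_S(y)|, as n^2 p >> n. *)

Require Import Defs.
From HB Require Import structures.
From mathcomp Require Import all_boot all_order all_algebra.
From mathcomp Require Import all_classical all_reals all_analysis.
From mathcomp Require Import ring lra zify.
Set Implicit Arguments.
Unset Strict Implicit.
Unset Printing Implicit Defensive.
Import Order.TTheory GRing.Theory Num.Theory.
Import numFieldNormedType.Exports.

Local Open Scope nat_scope.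

(** * Two-cores and leaf removal *)

(** The obstacle is the supremum over 2^n sets [S], for which a second-moment bound on the copies
    inside each [S] is too weak. Hence, in the error terms, copies inside [S] are bounded by copies
    in all of [n]: the rooted counts no longer depend on [S], and Markov's inequality is needed for
    boundedly many of them only. [S] remains in sums of independent centred edges, which have
    exponential tails. Copies of the core inside [S] are carried along without being estimated.
    Since the core of a connected graph that is not a tree has maximum degree at least 2, the
    threshold also forces (n p)^3 >= n for large [n], so that exp(- n p) outweighs a union over all
    vertices. *)

Section Peeling.
Variables (T : finType) (r : rel T).
Hypotheses (rsym : symmetric r) (rirr : irreflexive r).
Implicit Types (W J C V : {set T}) (u x y : T).

(** Edges live in [T] itself rather than in the subtype [vertex F], so that edge sets of nested
    vertex sets are comparable by inclusion; the orientation is that of [edges]. *)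
Definition edge_set W : {set T * T} :=
  [set ab | [&& ab.1 \in W, ab.2 \in W, r ab.1 ab.2 &
            enum_rank ab.1 < enum_rank ab.2]]%SET.

Definition sort_pair u x : T * T :=
  if enum_rank u < enum_rank x then (u, x) else (x, u).

Inductive peel C : {set T} -> Prop :=
| peel_core : peel C C
| peel_leaf W u x : peel C W -> u \notin W -> x \in W -> r u x ->
    (forall y, y \in W -> r u y -> y = x) -> peel C (u |: W)%SET.

Lemma edge_set_leaf W u x : u \notin W -> x \in W -> r u x ->
  (forall y, y \in W -> r u y -> y = x) ->
  edge_set (u |: W)%SET = (sort_pair u x |: edge_set W)%SET.
Proof.
move=> uW xW rux uniqx; apply/setP => -[a b]; rewrite !inE /= /sort_pair.
have neq_ux : (u == x) = false by apply: contraNF uW => /eqP->.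
have sxu : enum_rank u < enum_rank x \/ enum_rank x < enum_rank u.
  case: (ltngtP (enum_rank u) (enum_rank x)); [by left|by right|].
  by move=> /ord_inj/enum_rank_inj e; rewrite e eqxx in neq_ux.
have [->|nau] := eqVneq a u; have [->|nbu] := eqVneq b u.
- rewrite rirr /= !andbF orbF.
  by case: ifP => _; rewrite xpair_eqE ?neq_ux ?andbF // neq_ux.
- rewrite (negbTE uW) /= orbF.
  case: (boolP (b \in W)) => bW /=; last first.
    by case: ifP => _; rewrite xpair_eqE ?(negbTE nbu) ?neq_ux ?andbF //=;
      apply/esym/negbTE; apply: contraNN bW => /andP[_ /eqP->].
  case: (boolP (r u b)) => rub /=.
    rewrite (uniqx _ bW rub).
    by case: ifP => _; rewrite xpair_eqE ?eqxx ?neq_ux.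
  by case: ifP => _; rewrite xpair_eqE ?eqxx ?neq_ux //=;
    apply/esym/negbTE; apply: contraNN rub => /eqP->.
- rewrite (negbTE uW) /= !andbF orbF.
  case: (boolP (a \in W)) => aW /=; last first.
    by case: ifP => _; rewrite xpair_eqE ?(negbTE nau) //= eqxx andbT;
      apply/esym/negbTE; apply: contraNN aW => /eqP->.
  rewrite (rsym a).
  case: (boolP (r u a)) => rua /=.
    rewrite (uniqx _ aW rua).
    case: sxu => sxu; rewrite ?sxu ?xpair_eqE ?eqxx ?neq_ux ?(eq_sym x) ?neq_ux /=.
      by apply/negbTE; rewrite -leqNgt ltnW.
    by rewrite ifN ?eqxx // -leqNgt ltnW.
  by case: ifP => _; rewrite xpair_eqE ?(negbTE nau) //= eqxx andbT;
    apply/esym/negbTE; apply: contraNN rua => /eqP->.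
- by case: ifP => _; rewrite xpair_eqE ?(negbTE nau) ?(negbTE nbu) ?andbF.
Qed.

Lemma sort_pairNedge W u x : u \notin W -> sort_pair u x \notin edge_set W.
Proof.
by move=> uW; rewrite inE /sort_pair; case: ifP => _ /=; rewrite (negbTE uW) ?andbF.
Qed.

Lemma card_edge_set_leaf W u x : u \notin W -> x \in W -> r u x ->
  (forall y, y \in W -> r u y -> y = x) ->
  #|edge_set (u |: W)%SET| = #|edge_set W|.+1.
Proof.
by move=> uW xW rux h; rewrite (edge_set_leaf uW xW) // cardsU1 sort_pairNedge.
Qed.

Lemma edge_setS J W : J \subset W -> edge_set J \subset edge_set W.
Proof.
move=> /fintype.subsetP JW; apply/fintype.subsetP => -[a b]; rewrite !inE /= => /and4P[ha hb -> ->].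
by rewrite !JW.
Qed.

Lemma card_edge_set_leaf_sub J W u x : u \notin W -> x \in W -> r u x ->
  (forall y, y \in W -> r u y -> y = x) -> J \subset (u |: W)%SET ->
  #|edge_set J| <= #|edge_set (J :\ u)|.+1.
Proof.
move=> uW xW rux h sJ.
have : edge_set J \subset (sort_pair u x |: edge_set (J :\ u))%SET.
  apply/fintype.subsetP => -[a b] abJ.
  have := fintype.subsetP (edge_setS sJ) _ abJ; rewrite (edge_set_leaf uW xW) //.
  rewrite !inE /= => /orP[->//|/and4P[aW bW _ _]].
  move: abJ; rewrite !inE /= => /and4P[-> -> -> ->].
  have -> : (a != u) by apply: contraNneq uW => <-.
  have -> : (b != u) by apply: contraNneq uW => <-.
  by rewrite orbT.
move=> /subset_leq_card /leq_trans; apply.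
by rewrite cardsU1; case: (_ \notin _).
Qed.

(** The edges and their reversals, disjoint thanks to the orientation, lie among the ordered
    adjacent pairs in [J]. *)
Lemma handshake_le J m : (forall a, a \in J -> #|[set b in J | r a b]%SET| <= m) ->
  2 * #|edge_set J| <= m * #|J|.
Proof.
move=> hm.
have -> : m * #|J| = \sum_(a in J) m by rewrite sum_nat_const mulnC.
pose D := [set ab : T * T | [&& ab.1 \in J, ab.2 \in J & r ab.1 ab.2]]%SET.
have cD : #|D| <= \sum_(a in J) m.
  have -> : #|D| = \sum_(a in J) #|[set b in J | r a b]%SET|.
    rewrite -sum1_card (eq_bigl (fun ab : T * T =>
      (ab.1 \in J) && ((ab.2 \in J) && r ab.1 ab.2))); last first.
      by move=> ab; rewrite inE.
    rewrite -(pair_big_dep (fun a => a \in J) (fun a b => (b \in J) && r a b) (fun _ _ => 1%N)) /=.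
    apply: eq_bigr => a _; rewrite sum1_card; apply: eq_card => b.
    by rewrite [in RHS]inE.
  exact: leq_sum.
apply: leq_trans cD.
pose sw (ab : T * T) := (ab.2, ab.1).
have swinj : injective sw by move=> [a b] [c d'] [-> ->].
have -> : 2 * #|edge_set J| = #|edge_set J :|: sw @: edge_set J|.
  rewrite cardsU (card_imset _ swinj) mul2n -addnn.
  suff -> : (edge_set J :&: sw @: edge_set J)%SET = finset.set0 by rewrite cards0 subn0.
  apply/setP => ab; rewrite !inE; apply/negbTE/negP => /andP[/and4P[_ _ _ h1]].
  move=> /imsetP[[c d']]; rewrite inE => /and4P[_ _ _ h2] e.
  by move: h1; rewrite e /= ltnNge ltnW.
apply/subset_leq_card/fintype.subsetP => ab; rewrite !inE => /orP[/and4P[-> -> ->]//|].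
by move=> /imsetP[[c d']]; rewrite inE => /and4P[/= h1 h2 h3 _] -> /=; rewrite h1 h2 rsym.
Qed.

(* No nonempty proper subset of [W] is isolated inside [W]; unlike paths,
   this form of connectivity survives the removal of a leaf trivially. *)
Definition cut_connected W := forall A : {set T}, A \subset W -> A != finset.set0 -> A != W ->
  exists a b, [/\ a \in A, b \in W :\: A & r a b]%SET.

(** If [A] contains a neighbour of [u], the cut around [A] together with [u] gives an edge that
    cannot start at [u], whose only neighbour lies in [A]. Otherwise the cut around [A] gives an
    edge that cannot end at [u]. *)
Lemma cut_connected_leaf W u : cut_connected W -> u \in W ->
  (forall x y, x \in W -> y \in W -> r u x -> r u y -> x = y) ->
  cut_connected (W :\ u)%SET.
Proof.
move=> cW uW uniq A sA A0 AW.
have uA : u \notin A by apply/negP => /(fintype.subsetP sA); rewrite !inE eqxx.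
have sAW : A \subset W by apply: fintype.subset_trans sA (finset.subD1set _ _).
case: (boolP [exists x, (x \in A) && r u x]) => [/existsP[x /andP[xA rux]]|/existsPn nx].
- have [|||a [b []]] := cW (u |: A)%SET.
  + by rewrite finset.subUset finset.sub1set uW.
  + by apply/set0Pn; exists u; rewrite finset.setU11.
  + apply: contra_neq AW => <-.
    by rewrite finset.setU1K.
  rewrite !inE negb_or => /orP[/eqP->|aA] /andP[/andP[bu bA] bW] rab.
    by move: bA; rewrite -(uniq x b) ?xA // (fintype.subsetP sAW).
  by exists a, b; split => //; rewrite !inE bA bu.
- have [|||a [b [aA]]] := cW A; rewrite ?sAW //.
    by apply: contraNneq uA => ->.
  rewrite inE => /andP[bA bW] rab; exists a, b; split => //.
  rewrite !inE bA bW andbT; apply: contraTneq rab => ->.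
  by rewrite rsym; have := nx a; rewrite aA.
Qed.

(** As long as [V] exceeds [C], maximality of [C] provides a vertex with at most one neighbour in
    [V]. It lies outside [C], where degrees are at least 2, so it can be removed. *)
Lemma peel_cut_connected C V :
  C != finset.set0 -> C \subset V -> cut_connected V ->
  (forall x, x \in C -> 2 <= #|[set y in C | r x y]%SET|) ->
  (forall W : {set T}, W \subset V -> C \subset W ->
     (forall x, x \in W -> 2 <= #|[set y in W | r x y]%SET|) -> W \subset C) ->
  peel C V.
Proof.
move=> C0 sCV cV degC maxC.
have [m] := ubnP #|V|; elim: m => // m IH in V sCV cV maxC *; rewrite ltnS => leVm.
have [VC|VC] := boolP (V \subset C).
  have -> : V = C by apply/eqP; rewrite finset.eqEsubset VC.
  exact: peel_core.
have [/forallP h|/forallPn[u]] := boolP [forall x, (x \in V) ==> (2 <= #|[set y in V | r x y]%SET|)].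
  by case/negP: VC; apply: maxC => // x xV; have := h x; rewrite xV.
rewrite negb_imply -ltnNge ltnS => /andP[uV degu].
have uC : u \notin C.
  apply/negP => uC.
  have := degC _ uC; rewrite leqNgt => /negP[]; rewrite ltnS; apply: leq_trans degu.
  by apply/subset_leq_card/fintype.subsetP => y; rewrite !inE => /andP[/(fintype.subsetP sCV)-> ->].
have uniq x y : x \in V -> y \in V -> r u x -> r u y -> x = y.
  move=> xV yV rx ry; have /card_le1_eqP/(_ y x) := degu.
  by rewrite !inE xV yV => -> .
have sCVu : C \subset (V :\ u)%SET by rewrite finset.subsetD1 sCV.
(* Connectivity makes [u] a leaf rather than an isolated vertex: the cut around [u] is proper since
   [C] is nonempty and avoids [u]. *)
have [|||a [x []]] := cV [set u]%SET.
- by rewrite finset.sub1set.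
- by apply/set0Pn; exists u; rewrite inE.
- apply/negP => /eqP e; case/set0Pn: C0 => c cC; move: (fintype.subsetP sCV _ cC) uC.
  by rewrite -e inE => /eqP <-; rewrite cC.
rewrite !inE => /eqP-> /andP[xu xV] rux.
rewrite -(finset.setD1K uV); apply: (peel_leaf (x := x)) => //.
- apply: IH => //.
  + exact: cut_connected_leaf.
  + by move=> W sW; apply: maxC; apply: fintype.subset_trans sW (finset.subD1set _ _).
  + by apply: leq_trans leVm; rewrite [X in _ < X](cardsD1 u) uV.
- by rewrite !inE eqxx.
- by rewrite !inE xu xV.
- by move=> y; rewrite !inE => /andP[_ yV] ruy; apply: uniq.
Qed.

End Peeling.

(** * The two-core of a connected graph that is not a tree *)

Section TwoCore.
Variable T : finType.
Implicit Types (F H K : sgraph T) (W : {set T}).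

Lemma card_edges F : #|edges F| = #|edge_set (adj F) (verts F)|.
Proof.
pose h (ab : vertex F * vertex F) := (val ab.1, val ab.2).
have hinj : injective h by move=> [a b] [a' b'] [/val_inj-> /val_inj->].
rewrite -(card_imset _ hinj); apply: eq_card => -[a b]; apply/imsetP/idP.
  by move=> [[a' b']]; rewrite inE /= => hab [-> ->]; rewrite inE /= (valP a') (valP b').
rewrite inE => /and4P[/= ha hb hr hab].
by exists (exist _ a ha, exist _ b hb); rewrite // inE /= hr.
Qed.

Lemma prod_edges (V : comNzSemiRingType) F (f : T -> T -> V) :
  (\prod_(ab in edges F) f (val ab.1) (val ab.2) =
   \prod_(ab in edge_set (adj F) (verts F)) f ab.1 ab.2)%R.
Proof.
pose h (ab : vertex F * vertex F) := (val ab.1, val ab.2).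
have hinj : injective h by move=> [a b] [a' b'] [/val_inj-> /val_inj->].
have -> : edge_set (adj F) (verts F) = (h @: edges F)%SET.
  apply/setP => -[a b]; apply/idP/imsetP; last first.
    by move=> [[a' b']]; rewrite inE /= => hab [-> ->]; rewrite inE /= (valP a') (valP b').
  rewrite inE => /and4P[/= ha hb hr hab].
  by exists (exist _ a ha, exist _ b hb); rewrite // inE /= hr.
by rewrite big_imset //= => x y _ _; apply: hinj.
Qed.

Lemma degE F x : deg F x = #|[set y | adj F x y]%SET|.
Proof.
by apply: eq_card => y; rewrite [RHS]inE; apply/idP/idP => [/set_mem //|h]; apply/mem_set.
Qed.

Lemma adj_vertsr F x y : adj F x y -> y \in verts F.
Proof. by rewrite adj_sym; apply: adj_verts. Qed.

Definition induced_adj F W : rel T := fun x y => [&& x \in W, y \in W & adj F x y].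

Lemma induced_adj_sym F W : symmetric (induced_adj F W).
Proof. by move=> x y; rewrite /induced_adj adj_sym andbCA. Qed.

Lemma induced_adj_irr F W : irreflexive (induced_adj F W).
Proof. by move=> x; rewrite /induced_adj adj_irr !andbF. Qed.

Lemma induced_adj_verts F W x y : induced_adj F W x y -> x \in W.
Proof. by rewrite /induced_adj => /and3P[]. Qed.

Definition induced F W : sgraph T :=
  SGraph (@induced_adj_sym F W) (@induced_adj_irr F W) (@induced_adj_verts F W).

Lemma induced_subgraph F W : W \subset verts F -> subgraph (induced F W) F.
Proof. by split => // x y /and3P[]. Qed.

Lemma deg_induced F W x : x \in W ->
  deg (induced F W) x = #|[set y in W | adj F x y]%SET|.
Proof.
by move=> xW; rewrite degE; apply: eq_card => y; rewrite !inE /= /induced_adj xW.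
Qed.

Lemma connected_cut F : connected_graph F -> cut_connected (adj F) (verts F).
Proof.
move=> [_ cF] A sA /set0Pn[a aA] AV.
have /subsetPn[b bV bA] : ~~ (verts F \subset A).
  by apply: contra_neqN AV => sVA; apply/eqP; rewrite finset.eqEsubset sA.
have /connectP[q] := cF _ _ (fintype.subsetP sA _ aA) bV.
elim: q a aA => [|c q IH] a aA /=; first by move=> _ e; rewrite e aA in bA.
move=> /andP[ac qp] e; have [cA|cA] := boolP (c \in A); first exact: IH qp e.
by exists a, c; split => //; rewrite inE cA (adj_vertsr ac).
Qed.

(** The successor and the predecessor of [x] are distinct neighbours: otherwise two steps along the
    cycle would return to [x], which length at least 3 excludes. *)
Lemma two_le_degree_cycle F (c : seq T) x : (2 < size c)%N -> ucycle (adj F) c ->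
  x \in c -> (2 <= #|[set y in [set z in c] | adj F x y]%SET|)%N.
Proof.
move=> sz /andP[cc uc] xc.
have nx := next_cycle cc xc; have px := prev_cycle cc xc; rewrite adj_sym in px.
suff ne : next c x != prev c x.
  have sub : [set next c x; prev c x]%SET \subset [set y in [set z in c] | adj F x y]%SET.
    apply/fintype.subsetP => y; rewrite !inE.
    by case/orP => /eqP->; rewrite ?mem_next ?mem_prev xc ?nx ?px.
  by apply: leq_trans (subset_leq_card sub); rewrite cards2 ne.
apply/eqP => e.
have nnx : next c (next c x) = x by rewrite e next_prev.
have [i s es] := rot_to xc.
have : uniq (rot i c) by rewrite rot_uniq.
have : (2 < size (rot i c))%N by rewrite size_rot.
move: nnx; rewrite -!(next_rot i uc) es.
case: s {es} => [|y [|z s]] // + _.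
have -> : next [:: x, y, z & s] x = y by rewrite /next /next_at eqxx.
have [->|yx] := eqVneq y x; first by rewrite /= !inE eqxx.
have -> : next [:: x, y, z & s] y = z by rewrite /next /next_at (negbTE yx) eqxx.
by move=> ->; rewrite /= !inE eqxx !orbT.
Qed.

(** The vertices of a cycle induce a subgraph of minimum degree at least 2. Maximality only speaks
    of subgraphs containing [K]; an empty [K] is contained in all of them, so it would have to
    contain the cycle. *)
Lemma two_core_neq0 H K : connected_graph H -> ~ is_tree H -> is_two_core K H ->
  verts K != finset.set0.
Proof.
move=> cH ntH [sKH dK maxK]; apply/negP => /eqP K0; apply: ntH; split=> // c sc uc.
have cV : [set z in c]%SET \subset verts H.
  apply/fintype.subsetP => x; rewrite inE => xc.
  by case/andP: uc => /next_cycle/(_ xc)/adj_verts.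
have sub : subgraph (induced H [set z in c]%SET) K.
  apply: maxK; first exact: induced_subgraph.
    by move=> x /[dup] xc; rewrite deg_induced // inE => ?; exact: two_le_degree_cycle.
  split; first by rewrite K0 finset.sub0set.
  by move=> x y /adj_verts; rewrite K0 inE.
case: c sc {uc cV} sub => // x c _ [/fintype.subsetP/(_ x)] /=.
by rewrite K0 !inE eqxx => /(_ isT).
Qed.

(** Maximality is tested against the subgraph induced on [verts K], whose minimum degree is still at
    least 2: a two-core is induced. *)
Lemma two_core_adj H K x y : is_two_core K H -> x \in verts K -> y \in verts K ->
  adj K x y = adj H x y.
Proof.
move=> [[sV sA] dK maxK] xK yK; apply/idP/idP; first exact: sA.
move=> xy; have [|||_] := maxK (induced H (verts K)).
- exact: induced_subgraph.
- move=> z zK; rewrite deg_induced //; apply: leq_trans (dK _ zK) _; rewrite degE.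
  apply/subset_leq_card/fintype.subsetP => t; rewrite !inE => zt.
  by rewrite (adj_vertsr zt) sA.
- by split => // a b ab; rewrite /= /induced_adj (adj_verts ab) (adj_vertsr ab) sA.
- by apply; rewrite /= /induced_adj xK yK.
Qed.

Lemma edge_set_two_core H K : is_two_core K H ->
  edge_set (adj K) (verts K) = edge_set (adj H) (verts K).
Proof.
move=> core; apply/setP => -[a b]; rewrite !inE /=.
case: (boolP (a \in _)) => //= aK; case: (boolP (b \in _)) => //= bK.
by rewrite (two_core_adj core).
Qed.

Lemma two_core_peel H K : connected_graph H -> ~ is_tree H -> is_two_core K H ->
  peel (adj H) (verts K) (verts H).
Proof.
move=> cH ntH core; have [[sV sA] dK maxK] := core.
apply: peel_cut_connected => //.
- exact: adj_sym.
- exact: two_core_neq0 core.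
- exact: connected_cut.
- move=> x xK; apply: leq_trans (dK _ xK) _; rewrite degE.
  apply/subset_leq_card/fintype.subsetP => t; rewrite !inE => zt.
  by rewrite (adj_vertsr zt) sA.
- move=> W sWV sKW dW; have [||//|//] := maxK (induced H W).
  + exact: induced_subgraph.
  + by move=> x xW; rewrite deg_induced // dW.
  + by split => // a b ab; rewrite /= /induced_adj !(fintype.subsetP sKW) ?sA
      ?(adj_verts ab) ?(adj_vertsr ab).
Qed.

Lemma two_core_max_deg H K : connected_graph H -> ~ is_tree H -> is_two_core K H ->
  (2 <= max_deg K)%N.
Proof.
move=> cH ntH core; have /set0Pn[x xK] := two_core_neq0 cH ntH core.
by case: core => _ dK _; apply: leq_trans (dK _ xK) (leq_bigmax_cond _ xK).
Qed.

(** The minimum matters: for one or two vertices the bound by [max_deg K] is too weak for the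
    threshold, and the bound by the number of other vertices of [J] takes over. *)
Lemma two_core_card_edge_set H K (J : {set T}) : is_two_core K H -> J \subset verts K ->
  (2 * #|edge_set (adj H) J| <= minn (max_deg K) #|J|.-1 * #|J|)%N.
Proof.
move=> core sJ; apply: handshake_le; rewrite ?adj_sym //; first exact: adj_sym.
move=> a aJ; rewrite leq_min; apply/andP; split.
  apply: leq_trans (leq_bigmax_cond _ (fintype.subsetP sJ _ aJ)); rewrite degE.
  apply/subset_leq_card/fintype.subsetP => b; rewrite !inE => /andP[bJ].
  by rewrite (two_core_adj core) // (fintype.subsetP sJ).
rewrite (cardsD1 a J) aJ /=; apply/subset_leq_card/fintype.subsetP => b.
by rewrite !inE => /andP[-> ab]; rewrite andbT; apply: contraTneq ab => ->; rewrite adj_irr.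
Qed.

End TwoCore.

Local Open Scope ring_scope.

(** * Products of Bernoulli measures and the random graph *)

Section BernoulliProduct.
Variables (R : realType) (I : finType) (p : R).
Hypothesis p01 : 0 <= p <= 1.
Implicit Types (c : {ffun I -> bool}) (f g : {ffun I -> bool} -> R).

Definition bernoulli_weight (b : bool) : R := if b then p else 1 - p.

Definition weight c : R := \prod_i bernoulli_weight (c i).

Definition expect f : R := \sum_c weight c * f c.

Lemma weight_ge0 c : 0 <= weight c.
Proof.
case/andP: p01 => p0 p1; apply: prodr_ge0 => i _.
by rewrite /bernoulli_weight; case: (c i) => //; rewrite subr_ge0.
Qed.

Lemma expect_prod (h : I -> bool -> R) :
  expect (fun c => \prod_i h i (c i)) =
  \prod_i (p * h i true + (1 - p) * h i false).
Proof.
transitivity (\sum_(c : {ffun I -> bool}) \prod_i (bernoulli_weight (c i) * h i (c i))).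
  by apply: eq_bigr => c _; rewrite big_split.
rewrite -(bigA_distr_bigA (fun i b => bernoulli_weight b * h i b)).
by apply: eq_bigr => i _; rewrite big_bool.
Qed.

Lemma le_expect f g : (forall c, f c <= g c) -> expect f <= expect g.
Proof. by move=> fg; apply: ler_sum => c _; rewrite ler_wpM2l // weight_ge0. Qed.

Lemma eq_expect f g : f =1 g -> expect f = expect g.
Proof. by move=> fg; apply: eq_bigr => c _; rewrite fg. Qed.

Lemma expect_sum (K : finType) (A : pred K) (h : K -> {ffun I -> bool} -> R) :
  expect (fun c => \sum_(k | A k) h k c) = \sum_(k | A k) expect (h k).
Proof. by rewrite exchange_big; apply: eq_bigr => c _; rewrite mulr_sumr. Qed.

Lemma expectZ a f : expect (fun c => a * f c) = a * expect f.
Proof. by rewrite /expect mulr_sumr; apply: eq_bigr => c _; rewrite mulrCA. Qed.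

Lemma weight_markov (A : pred {ffun I -> bool}) f :
  (forall c, 0 <= f c) -> (forall c, A c -> 1 <= f c) ->
  \sum_(c | A c) weight c <= expect f.
Proof.
move=> f0 f1; rewrite big_mkcond /=; apply: ler_sum => c _.
case: ifP => [/f1 h|_]; last by rewrite mulr_ge0 ?weight_ge0.
by rewrite -[X in X <= _]mulr1 ler_wpM2l ?weight_ge0.
Qed.

(** Injectivity of [o] makes the factors independent. Coordinates are options because [upair_of] has
    none for a pair of equal vertices. *)
Lemma expect_all (K : finType) (A : {set K}) (o : K -> option I) :
  (forall k, k \in A -> o k != None) -> {in A &, injective o} ->
  expect (fun c => \prod_(k in A) ((oapp c false (o k))%:R : R)) = p ^+ #|A|.
Proof.
move=> oN oinj.
pose F := [set i | Some i \in o @: A]%SET.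
have oF : (o @: A = Some @: F)%SET.
  apply/setP => -[i|]; apply/idP/imsetP.
  - by move=> h; exists i; rewrite ?inE.
  - by move=> [j + [->]]; rewrite inE.
  - by move/imsetP => [k kA e]; have := oN k kA; rewrite -e.
  - by move=> [].
have <- : #|F| = #|A|.
  by rewrite -(card_imset F (@Some_inj _)) -oF card_in_imset.
have E c : \prod_(k in A) ((oapp c false (o k))%:R : R) =
           \prod_i (if i \in F then (c i)%:R else 1).
  rewrite -(big_imset (fun j => (oapp c false j)%:R)) //= oF big_imset /=.
    by rewrite big_mkcond.
  by move=> ? ? _ _ [].
rewrite (eq_expect E) (expect_prod (fun i b => if i \in F then b%:R else 1)).
rewrite -prodr_const [RHS]big_mkcond; apply: eq_bigr => i _ /=.
by case: ifP => _; rewrite ?mulr1 ?mulr0 ?addr0 //; lra.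
Qed.

(** Inverting 1 - x <= exp(- x) gives exp x <= 1 / (1 - x), and (1 - x) (1 + x + 2 x^2) = 1 + x^2 (1
    - 2 x) >= 1 in this range. *)
Lemma expR_le_quadratic (x : R) : x <= 2^-1 -> expR x <= 1 + x + 2 * x ^+ 2.
Proof.
move=> xh; have x1 : 0 < 1 - x by lra.
have : expR x <= (1 - x)^-1.
  rewrite -[x in expR x]opprK expRN lef_pV2 ?posrE ?expR_gt0 //.
  by have := expR_ge1Dx (- x).
move/le_trans; apply; rewrite -[X in X <= _]mul1r ler_pdivrMr //.
by have : 0 <= x ^+ 2 * (1 - 2 * x) by [apply: mulr_ge0; [exact: sqr_ge0|lra]]; lra.
Qed.

(** Moment generating function of a centred sum, factor by factor. Pulling out exp(- a p) and
    applying 1 + p (exp a - 1) <= exp(p (a + 2 a^2)) keeps the factor [p] of the variance in the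
    exponent. *)
Lemma expect_expR (a : I -> R) : (forall i, a i <= 2^-1) ->
  expect (fun c => expR (\sum_i a i * ((c i)%:R - p))) <=
  expR (2 * p * \sum_i a i ^+ 2).
Proof.
case/andP: (p01) => p0 p1 ha.
under eq_expect do rewrite expR_sum.
rewrite (expect_prod (fun i b => expR (a i * (b%:R - p)))).
rewrite mulr_sumr expR_sum; apply: ler_prod => i _; apply/andP; split.
  by rewrite addr_ge0 // mulr_ge0 ?expR_ge0 // subr_ge0.
have -> : p * expR (a i * (1 - p)) + (1 - p) * expR (a i * (0 - p)) =
    expR (- (a i * p)) * (1 + p * (expR (a i) - 1)).
  rewrite mulrBr mulr1 sub0r mulrN expRD; ring.
have -> : expR (2 * p * a i ^+ 2) =
    expR (- (a i * p)) * expR (p * (a i + 2 * a i ^+ 2)).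
  by rewrite -expRD; congr expR; ring.
rewrite ler_wpM2l ?expR_ge0 //; apply: le_trans (expR_ge1Dx _).
by rewrite lerD2l ler_wpM2l //; have := expR_le_quadratic (ha i); lra.
Qed.

End BernoulliProduct.

(** * Graphs on [n] as families of Boolean coordinates *)

Section Configurations.
Variable n : nat.

Notation upair := {ij : 'I_n * 'I_n | (ij.1 < ij.2)%N}.
Implicit Types (i j k l : 'I_n) (c : {ffun upair -> bool}).

Definition upair_of i j : option upair :=
  if insub (i, j) is Some e then Some e else insub (j, i).

Definition config_graph c i j : bool := oapp c false (upair_of i j).

Lemma upair_of_lt (e : upair) : upair_of (val e).1 (val e).2 = Some e.
Proof. by rewrite /upair_of -surjective_pairing valK. Qed.

Lemma upair_ofC i j : upair_of i j = upair_of j i.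
Proof.
rewrite /upair_of; case: insubP => [e /= ij ve|/= nij]; case: insubP => [e' /= ji ve'|/= nji] //.
by have := ltn_trans ij ji; rewrite ltnn.
Qed.

Lemma upair_of_neq i j : i != j -> upair_of i j != None.
Proof.
move=> ij; have [ltij|ltji|e] := ltngtP i j.
- by rewrite /upair_of insubT.
- by rewrite upair_ofC /upair_of insubT.
- by rewrite (val_inj e) eqxx in ij.
Qed.

Lemma upair_of_id i : upair_of i i = None.
Proof. by rewrite /upair_of insubN //= ltnn. Qed.

Lemma upair_of_inj i j k l : i != j -> upair_of i j = upair_of k l ->
  (i, j) = (k, l) \/ (i, j) = (l, k).
Proof.
have h a b (e : upair) : upair_of a b = Some e -> val e = (a, b) \/ val e = (b, a).
  rewrite /upair_of; case: insubP => [e' _ ve [<-]|_]; first by left.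
  by case: insubP => // e' _ ve [<-]; right.
move=> /upair_of_neq; case E: (upair_of i j) => [e|//] _ /esym E'.
by case: (h _ _ _ E) (h _ _ _ E') => -> [[-> ->]|[-> ->]]; auto.
Qed.

Lemma config_graphC c i j : config_graph c i j = config_graph c j i.
Proof. by rewrite /config_graph upair_ofC. Qed.

Lemma config_graph_lt c (e : upair) : config_graph c (val e).1 (val e).2 = c e.
Proof. by rewrite /config_graph upair_of_lt. Qed.

Lemma config_graph_irr c i : config_graph c i i = false.
Proof. by rewrite /config_graph upair_of_id. Qed.

(** The entries (i, j) and (j, i) read the same coordinate of a configuration, so a sum over ordered
    pairs has to be regrouped before independence applies. *)
Lemma sum_pairs (V : nmodType) (F : 'I_n -> 'I_n -> V) :
  \sum_i \sum_j F i j =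
  \sum_(e : upair) (F (val e).1 (val e).2 + F (val e).2 (val e).1) + \sum_i F i i.
Proof.
rewrite pair_big /= big_split /=.
rewrite -(big_sub [pred ij : 'I_n * 'I_n | (ij.1 < ij.2)%N] (fun ij => F ij.1 ij.2)).
rewrite -(big_sub [pred ij : 'I_n * 'I_n | (ij.1 < ij.2)%N] (fun ij => F ij.2 ij.1)).
rewrite (bigID (fun ij : 'I_n * 'I_n => (ij.1 < ij.2)%N)) /= -addrA; congr (_ + _).
rewrite (bigID (fun ij : 'I_n * 'I_n => (ij.2 < ij.1)%N)) /=; congr (_ + _).
  rewrite [RHS](reindex_inj (h := fun ij : 'I_n * 'I_n => (ij.2, ij.1))) /=; last first.
    by move=> [a b] [a' b'] [-> ->].
  apply: eq_bigl => -[a b] /=. rewrite inE /=. by case: ltngtP.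
rewrite (eq_bigl (fun ij : 'I_n * 'I_n => xpredT ij.1 && (ij.2 == ij.1))); last first.
  move=> [a b] /=; rewrite -!leqNgt -eqn_leq; apply/eqP/eqP => [e|->//].
  exact: val_inj.
rewrite -(pair_big_dep xpredT (fun i j => j == i) F) /=.
by apply: eq_bigr => i _; rewrite big_pred1_eq.
Qed.

End Configurations.

Notation upair n := {ij : 'I_n * 'I_n | (ij.1 < ij.2)%N}.

(** * From abstract random variables to the finite product measure *)

Section Transfer.
Variables (R : realType) (d : measure_display) (Omega : measurableType d).
Variables (P : probability Omega R) (n : nat) (p : R).
Variable G : 'I_n -> 'I_n -> {RV P >-> bool}.
Hypotheses (p01 : 0 <= p <= 1) (GER : erdos_renyi p G).

Definition config_of (w : Omega) : {ffun upair n -> bool} :=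
  [ffun e => G (val e).1 (val e).2 w].

Lemma config_ofE w i j : G i j w = config_graph (config_of w) i j.
Proof.
case: GER => _ _ Gsym Girr; have [ij|ji|ij] := ltngtP i j.
- by have := config_graph_lt (config_of w) (exist _ (i, j) ij); rewrite ffunE /= => ->.
- rewrite config_graphC Gsym.
  by have := config_graph_lt (config_of w) (exist _ (j, i) ji); rewrite ffunE /= => ->.
- by rewrite (val_inj ij) Girr config_graph_irr.
Qed.

Lemma bernoulli_prob1 b : bernoulli_prob p [set b]%classic = (bernoulli_weight p b)%:E.
Proof.
rewrite bernoulli_probE // !diracE.
have mem1 (a : bool) : (a \in [set b]%classic) = (a == b).
  by apply/idP/eqP => [/set_mem//|->]; exact/mem_set.
by rewrite !mem1; case: b {mem1} => /=; rewrite ?mule1 ?mule0 ?adde0 ?add0e.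
Qed.

Lemma config_of_preimage (c : {ffun upair n -> bool}) :
  (config_of @^-1` [set c])%classic =
  (\bigcap_(e in [set` [set: upair n]%SET])
     ((fun e : upair n => G (val e).1 (val e).2) e @^-1` [set c e]))%classic.
Proof.
apply/seteqP; split => [w /= <- e _ /=|w h]; first by rewrite ffunE.
by apply/ffunP => e; rewrite ffunE; apply: h; rewrite /= inE.
Qed.

Lemma measurable_config c : measurable (config_of @^-1` [set c])%classic.
Proof.
rewrite config_of_preimage; apply: fin_bigcap_measurable => // e _.
by rewrite -[X in measurable X]setTI; apply: measurable_funP.
Qed.

Lemma prob_config1 c : P (config_of @^-1` [set c])%classic = (weight p c)%:E.
Proof.
case: GER => Gdist Gind _ _; rewrite config_of_preimage.
rewrite (Gind [set: upair n]%SET (fun e => [set c e]%classic)) //.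
rewrite /weight -prodEFin; apply: eq_big => [e|e _]; first by rewrite inE.
have := Gdist (val e).1 (val e).2 (valP e) [set c e]%classic.
by rewrite bernoulli_prob1.
Qed.

(** The event is a finite disjoint union of fibres of [config_of]; probabilities thus become finite
    weighted sums over configurations. *)
Lemma prob_config (A : pred {ffun upair n -> bool}) :
  P [set w | A (config_of w)]%classic = (\sum_(c | A c) weight p c)%:E.
Proof.
have -> : [set w | A (config_of w)]%classic =
   (\bigcup_(c in [set` A]) (config_of @^-1` [set c]))%classic.
  by apply/seteqP; split => [w /= Aw|w [c /= Ac e]]; [exists (config_of w)|rewrite e].
rewrite measure_fin_bigcup //.
- rewrite -(bigfs _ (r := index_enum _) (P := A)) ?index_enum_uniq //.
    by rewrite -sumEFin; apply: eq_bigr => c _; exact: prob_config1.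
  by move=> c; rewrite mem_index_enum.
- by move=> c c' _ _ [w [/= e e']]; rewrite -e -e'.
- by move=> c _; exact: measurable_config.
Qed.

End Transfer.

(** * Chernoff bounds for degrees and for signed cuts *)

Section Discrepancy.
Variables (R : realType) (n : nat) (p : R).
Hypothesis p01 : 0 <= p <= 1.
Implicit Types (c : {ffun upair n -> bool}) (S : {set 'I_n}).

Definition weighted_deviation (b : 'I_n -> 'I_n -> R) c : R :=
  \sum_i \sum_j b i j * ((config_graph c i j)%:R - p).

(** The term t p n pays for the diagonal, where each summand is - p times [b i i]. Off the diagonal
    a coordinate has coefficient t (b i j + b j i), at most 1/2 since t <= 1/4, and (x + y)^2 <= 2
    (x^2 + y^2) turns the 2 of [expect_expR] into 4. *)
Lemma expect_expR_deviation (b : 'I_n -> 'I_n -> R) (t : R) :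
  0 <= t <= 4^-1 -> (forall i j, `|b i j| <= 1) ->
  expect p (fun c => expR (t * weighted_deviation b c)) <=
  expR (t * (p * n%:R) + 4 * p * t ^+ 2 * \sum_i \sum_j b i j ^+ 2).
Proof.
case/andP: (p01) => p0 p1 /andP[t0 t4] b1.
pose a (e : upair n) := t * (b (val e).1 (val e).2 + b (val e).2 (val e).1).
have split_dev c : t * weighted_deviation b c =
    t * (\sum_i b i i * (0 - p)) + \sum_e a e * ((c e)%:R - p).
  rewrite /weighted_deviation sum_pairs mulrDr addrC; congr (_ + _).
    by congr (_ * _); apply: eq_bigr => i _; rewrite config_graph_irr.
  rewrite mulr_sumr; apply: eq_bigr => e _.
  by rewrite [config_graph c (val e).2 _]config_graphC !config_graph_lt /a; ring.
have diag : t * (\sum_i b i i * (0 - p)) <= t * (p * n%:R).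
  rewrite ler_wpM2l //; apply: (@le_trans _ _ (\sum_(i < n) p)); last first.
    by rewrite sumr_const card_ord mulr_natr.
  apply: ler_sum => i _; rewrite sub0r mulrN -mulNr -[leRHS]mul1r ler_wpM2r //.
  by have := b1 i i; rewrite ler_norml => /andP[]; lra.
apply: (@le_trans _ _ (expR (t * (p * n%:R)) *
    expect p (fun c => expR (\sum_e a e * ((c e)%:R - p))))).
  rewrite -expectZ; apply: le_expect => // c.
  by rewrite split_dev -expRD ler_expR lerD2r.
rewrite expRD ler_wpM2l ?expR_ge0 //.
apply: (le_trans (expect_expR _ _)) => //.
  move=> e; rewrite /a.
  have h1 := le_trans (ler_norm _) (b1 (val e).1 (val e).2).
  have h2 := le_trans (ler_norm _) (b1 (val e).2 (val e).1).
  apply: (@le_trans _ _ (t * 2)); last lra.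
  by rewrite ler_wpM2l //; lra.
rewrite ler_expR.
have -> : 4 * p * t ^+ 2 * (\sum_i \sum_j b i j ^+ 2) =
    2 * p * (2 * t ^+ 2 * \sum_i \sum_j b i j ^+ 2) by ring.
rewrite ler_wpM2l ?mulr_ge0 // sum_pairs mulrDr mulr_sumr.
rewrite -[leLHS]addr0 lerD //; last first.
  by rewrite mulr_ge0 ?mulr_ge0 ?sqr_ge0 //; apply: sumr_ge0 => i _; exact: sqr_ge0.
apply: ler_sum => e _; rewrite /a exprMn.
have -> : 2 * t ^+ 2 * (b (val e).1 (val e).2 ^+ 2 + b (val e).2 (val e).1 ^+ 2) =
  t ^+ 2 * (2 * (b (val e).1 (val e).2 ^+ 2 + b (val e).2 (val e).1 ^+ 2)) by ring.
rewrite ler_wpM2l ?sqr_ge0 //.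
by have := sqr_ge0 (b (val e).1 (val e).2 - b (val e).2 (val e).1); lra.
Qed.

Lemma deviation_tail (b : 'I_n -> 'I_n -> R) (t a : R) :
  0 <= t <= 4^-1 -> (forall i j, `|b i j| <= 1) ->
  \sum_(c | a < weighted_deviation b c) weight p c <=
  expR (t * (p * n%:R) + 4 * p * t ^+ 2 * (\sum_i \sum_j b i j ^+ 2) - t * a).
Proof.
move=> /[dup] ht /andP[t0 _] hb.
apply: (le_trans (weight_markov p01
  (f := fun c => expR (- (t * a)) * expR (t * weighted_deviation b c)) _ _)).
- by move=> c; rewrite mulr_ge0 ?expR_ge0.
- move=> c /ltW ac; rewrite -expRD -expR0 ler_expR addrC subr_ge0.
  by rewrite ler_wpM2l.
- rewrite expectZ addrC expRD ler_wpM2l ?expR_ge0 //.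
  exact: expect_expR_deviation.
Qed.

(** With these coefficients [weighted_deviation] is the degree of [y] minus p n. *)
Definition star (y i j : 'I_n) : R := (i == y)%:R.

(** With suitable signs [s], the [weighted_deviation] of these coefficients is the sum over all
    vertices of the absolute deviations into [S], here written as a linear statistic. *)
Definition signed_cut (s : {ffun 'I_n -> bool}) S (i j : 'I_n) : R :=
  (-1) ^+ s i * (j \in S)%:R.

Definition dense_star : pred {ffun upair n -> bool} := fun c =>
  [exists y, 6 * (p * n%:R) < weighted_deviation (star y) c].

Definition uneven_cut (lam : R) : pred {ffun upair n -> bool} := fun c =>
  [exists sS : {ffun 'I_n -> bool} * {set 'I_n},
     lam * p * n%:R ^+ 2 < weighted_deviation (signed_cut sS.1 sS.2) c].

Lemma union_bound (K : finType) (A : K -> pred {ffun upair n -> bool}) :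
  \sum_(c | [exists k, A k c]) weight p c <= \sum_k \sum_(c | A k c) weight p c.
Proof.
under [leRHS]eq_bigr do rewrite big_mkcond.
rewrite exchange_big big_mkcond; apply: ler_sum => c _ /=.
have pos (Q : pred K) : 0 <= \sum_(i | Q i) (if A i c then weight p c else 0).
  by apply: sumr_ge0 => i _; case: ifP => // _; exact: weight_ge0.
case: ifP => [/existsP[k Akc]|_]; last exact: pos.
by rewrite (bigD1 k) //= Akc lerDl.
Qed.

Lemma dense_star_tail :
  \sum_(c | dense_star c) weight p c <= n%:R * expR (- (p * n%:R)).
Proof.
apply: le_trans (union_bound (fun y c => 6 * (p * n%:R) < weighted_deviation (star y) c)) _.
apply: (@le_trans _ _ (\sum_(y < n) expR (- (p * n%:R)))); last first.
  by rewrite sumr_const card_ord mulr_natl.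
(* With t = 1/4 the exponent is (1/4 + 1/4 - 6/4) p n = - p n, whence the 6 in [dense_star]. *)
apply: ler_sum => y _; apply: (le_trans (@deviation_tail (star y) 4^-1 _ _ _)).
- by apply/andP; split; lra.
- by move=> i j; rewrite /star; case: (i == y); rewrite ?normr1 ?normr0.
rewrite ler_expR.
have -> : \sum_i \sum_j star y i j ^+ 2 = n%:R :> R.
  rewrite (bigD1 y) //= [X in _ + X]big1 => [|i iy]; last first.
    by rewrite big1 // => j _; rewrite /star (negbTE iy) expr0n.
  by rewrite addr0 /star eqxx expr1n sumr_const card_ord.
by lra.
Qed.

(** With t = lam / 8 the exponent is lam p n / 8 - lam^2 p n^2 / 16. The first term is at most n / 4
    and the subtracted one at least 4 n, which leaves at most - 3 n; two factors exp n then pay for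
    the 2^n sign patterns and the 2^n sets. *)
Lemma uneven_cut_tail (lam : R) : 0 < lam <= 2 -> 64 <= lam ^+ 2 * (p * n%:R) ->
  \sum_(c | uneven_cut lam c) weight p c <= expR (- n%:R).
Proof.
case/andP: (p01) => p0 p1 /andP[l0 l2] hl.
apply: le_trans (union_bound (fun (sS : {ffun 'I_n -> bool} * {set 'I_n}) c =>
  lam * p * n%:R ^+ 2 < weighted_deviation (signed_cut sS.1 sS.2) c)) _.
apply: (@le_trans _ _ (\sum_(sS : {ffun 'I_n -> bool} * {set 'I_n}) expR (- (3 * n%:R)))).
  apply: ler_sum => -[s S] _ /=; apply: (le_trans (@deviation_tail (signed_cut s S) (lam / 8) _ _ _)).
  - by apply/andP; split; lra.
  - move=> i j; rewrite /signed_cut normrM normrX normrN1 expr1n mul1r.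
    by case: (j \in S); rewrite ?normr1 ?normr0.
  rewrite ler_expR.
  have : \sum_i \sum_j signed_cut s S i j ^+ 2 <= n%:R ^+ 2 :> R.
    apply: (@le_trans _ _ (\sum_(i < n) \sum_(j < n) 1)); last first.
      by rewrite !sumr_const card_ord -[_ *+ n]mulr_natr expr2.
    apply: ler_sum => i _; apply: ler_sum => j _.
    rewrite /signed_cut exprMn -exprM mulnC exprM sqrrN !expr1n mul1r.
    by case: (j \in S); rewrite ?expr1n ?expr0n.
  set B := \sum_i _ => hB; set N : R := n%:R in hl hB *.
  have N0 : 0 <= N by rewrite ler0n.
  have h1 : 4 * p * (lam / 8) ^+ 2 * B <= 4 * p * (lam / 8) ^+ 2 * N ^+ 2.
    by rewrite ler_wpM2l // mulr_ge0 ?sqr_ge0 // mulr_ge0.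
  have h2 : 64 * N <= lam ^+ 2 * (p * N) * N by rewrite ler_wpM2r.
  have h3 : lam * (p * N) <= 2 * N.
    apply: ler_pM; rewrite ?mulr_ge0 ?(ltW l0) //.
    by rewrite -[leRHS]mul1r ler_wpM2r.
  by lra.
have card_sets : #|{: {set 'I_n}}| = (2 ^ n)%N.
  by rewrite -[LHS]cardsT -powersetT card_powerset cardsT card_ord.
rewrite sumr_const card_prod card_ffun card_bool card_sets card_ord -[_ *+ _]mulr_natl natrM natrX.
have -> : expR (- n%:R) = expR n%:R * expR n%:R * expR (- (3 * n%:R)) :> R.
  by rewrite -!expRD; congr expR; lra.
rewrite ler_wpM2r ?expR_ge0 //.
have : (2 ^+ n : R) <= expR n%:R.
  rewrite -[n%:R]mulr1 expRM_natl lerXn2r ?nnegrE ?expR_ge0 //.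
  by have := expR_ge1Dx (1 : R); lra.
by move=> h; rewrite ler_pM ?exprn_ge0.
Qed.

Definition deviation c S y : R := \sum_(z in S) ((config_graph c y z)%:R - p).

Lemma sum_deviation_le (lam : R) c S : ~~ uneven_cut lam c ->
  \sum_y `|deviation c S y| <= lam * p * n%:R ^+ 2.
Proof.
move=> /existsPn/(_ ([ffun y => deviation c S y < 0], S)); rewrite -leNgt.
apply: le_trans; apply: ler_sum => y _; rewrite /signed_cut /= ffunE.
have -> : \sum_j (-1) ^+ (deviation c S y < 0)%R * (j \in S)%:R * ((config_graph c y j)%:R - p) =
    (-1) ^+ (deviation c S y < 0)%R * deviation c S y.
  rewrite /deviation mulr_sumr [RHS]big_mkcond; apply: eq_bigr => j _.
  by case: (j \in S); rewrite ?mulr1 // mulr0 mul0r.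
by rewrite -normrEsign.
Qed.

(** From above, the degree into [S] is at most the full degree, hence at most 6 p n + p n; from
    below, the deviation is at least - p |S|. *)
Lemma deviation_le c S y : ~~ dense_star c -> `|deviation c S y| <= 7 * (p * n%:R).
Proof.
case/andP: (p01) => p0 p1.
move=> /existsPn/(_ y); rewrite -leNgt => h.
have deg_le : \sum_z (config_graph c y z)%:R <= 7 * (p * n%:R).
  move: h; rewrite /weighted_deviation (bigD1 y) //= [X in _ + X]big1 ?addr0; last first.
    by move=> i iy; rewrite big1 // => j _; rewrite /star (negbTE iy) mul0r.
  under eq_bigr do rewrite /star eqxx mul1r.
  by rewrite big_split /= sumr_const card_ord -mulr_natr; lra.
have pn0 : 0 <= p * n%:R by rewrite mulr_ge0.
rewrite /deviation big_split /= sumr_const -mulr_natr ler_norml; apply/andP; split.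
  have : 0 <= \sum_(z in S) ((config_graph c y z)%:R : R) by apply: sumr_ge0.
  have : p * #|S|%:R <= p * n%:R.
    by rewrite ler_wpM2l // ler_nat -[leqRHS]card_ord max_card.
  by lra.
have : \sum_(z in S) ((config_graph c y z)%:R : R) <= \sum_z (config_graph c y z)%:R.
  by rewrite [leRHS](bigID [in S]) /= lerDl sumr_ge0.
have : 0 <= p * #|S|%:R by rewrite mulr_ge0.
by lra.
Qed.

End Discrepancy.

(** * Counting copies *)

Section Placements.
Variables (R : realType) (T : finType) (n : nat).
Implicit Types (W J : {set T}) (S : {set 'I_n}) (phi psi : {ffun T -> 'I_n}).
Implicit Types (g : 'I_n -> 'I_n -> bool) (r : rel T).

(* Maps are defined on all of [T] but only their values on [W] matter; the
   sums below are thus [n ^ (#|T| - #|W|)] times sums over maps on [W]. *)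
Definition placed W S phi : bool := dinjectiveb phi W && (phi @: W \subset S).

Definition edge_prod r g W phi : R :=
  \prod_(ab in edge_set r W) (g (phi ab.1) (phi ab.2))%:R.

Definition placements r g W S : R := \sum_(phi | placed W S phi) edge_prod r g W phi.

Lemma edge_prod_ge0 r g W phi : 0 <= edge_prod r g W phi.
Proof. exact: prodr_ge0. Qed.

Lemma copies_placements (F : sgraph T) S g : (0 < n)%N ->
  (n%:R ^+ #|verts F|)^-1 * (copies F S g)%:R =
  (n%:R ^+ #|T|)^-1 * placements (adj F) g (verts F) S :> R.
Proof.
move=> n0; set W := verts F.
pose restr phi : {ffun vertex F -> 'I_n} := [ffun x => phi (val x)].
have placedE phi : placed W S phi =
    injectiveb (restr phi) && [forall x, restr phi x \in S].
  apply/andP/andP => -[h1 h2]; split.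
  - apply/injectiveP => a b; rewrite !ffunE => e; apply: val_inj.
    by move/dinjectiveP: h1; apply => //; apply: valP.
  - apply/forallP => a; rewrite ffunE; apply: (fintype.subsetP h2).
    by apply: imset_f; apply: valP.
  - apply/dinjectiveP => a b aW bW e.
    have : (exist _ a aW : vertex F) = exist _ b bW.
      by move/injectiveP: h1; apply; rewrite !ffunE.
    by move=> [].
  - apply/fintype.subsetP => _ /imsetP[a aW ->].
    by have := forallP h2 (exist _ a aW); rewrite ffunE.
have fiber (f : {ffun vertex F -> 'I_n}) :
    #|[pred phi : {ffun T -> 'I_n} | restr phi == f]| = (n ^ (#|T| - #|W|))%N.
  pose A (a : T) : pred 'I_n :=
    if insub a is Some x then pred1 (f x) else predT.
  have -> : #|[pred phi | restr phi == f]| = #|family A|.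
    apply: eq_card => phi; rewrite inE; apply/eqP/familyP => [e a|h].
      by rewrite /A -e; case: insubP => [x _ <-|_]; rewrite ?inE ?ffunE.
    apply/ffunP => x; rewrite ffunE; apply/eqP.
    by have := h (val x); rewrite /A valK inE.
  rewrite card_family foldrE big_map big_enum /=.
  rewrite (bigID [in W]) /= big1 ?mul1n => [|a aW]; last first.
    by rewrite /A insubT card1.
  rewrite (eq_bigr (fun=> n)) => [|a aW]; last first.
    by rewrite /A insubN // -[RHS]card_ord; apply: eq_card.
  rewrite prod_nat_const; congr (_ ^ _)%N.
  by rewrite -(cardC [in W]) addKn; apply: eq_card.
have -> : placements (adj F) g W S = (copies F S g * n ^ (#|T| - #|W|))%:R.
  rewrite /placements (partition_big restr
    (fun f => injectiveb f && [forall x, f x \in S])) => [|phi]; last by rewrite placedE.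
  rewrite /copies big_distrl natr_sum /=; apply: eq_bigr => f hf.
  rewrite (eq_bigr (fun=> (\prod_(ab in edges F) g (f ab.1) (f ab.2))%:R)).
    rewrite (eq_bigl [pred phi | restr phi == f]) => [|phi]; last first.
      by rewrite /= placedE; case: eqP => [->|]; rewrite ?hf ?andbF.
    by rewrite sumr_const fiber natrM mulr_natr.
  move=> phi /andP[_ /eqP <-]; rewrite natr_prod /edge_prod.
  rewrite -(prod_edges _ (fun a b => (g (phi a) (phi b))%:R)).
  by apply: eq_bigr => ab _; rewrite !ffunE.
have leWT : (#|W| <= #|T|)%N by exact: max_card.
have N0 : n%:R != 0 :> R by rewrite pnatr_eq0 -lt0n.
rewrite natrM natrX; set k := (#|T| - #|W|)%N.
have -> : #|T| = (k + #|W|)%N by rewrite subnK.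
rewrite exprD; field.
by rewrite !expf_neq0.
Qed.

Definition update phi u z : {ffun T -> 'I_n} := [ffun a => if a == u then z else phi a].

(** Exchanging [z] with the value of [phi] at [u] is an involution on pairs, which absorbs the
    dependence on [z] into the map. *)
Lemma sum_update (f : {ffun T -> 'I_n} -> R) u :
  \sum_phi \sum_z f (update phi u z) = n%:R * \sum_phi f phi.
Proof.
rewrite pair_big /=.
pose h (q : {ffun T -> 'I_n} * 'I_n) := (update q.1 u q.2, q.1 u).
have hK : involutive h.
  move=> [phi z]; rewrite /h /=; congr (_, _); last by rewrite ffunE eqxx.
  by apply/ffunP => a; rewrite !ffunE; case: eqP => [->|].
rewrite (reindex_inj (inv_inj hK)) /=.
rewrite (eq_bigr (fun q : {ffun T -> 'I_n} * 'I_n => f q.1)); last first.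
  by move=> q _; congr f; exact: (congr1 fst (hK q)).
rewrite -(pair_big xpredT xpredT (fun phi (z : 'I_n) => f phi)) /= mulr_sumr.
by apply: eq_bigr => phi _; rewrite sumr_const card_ord mulr_natl.
Qed.

Lemma placed_card W S phi : placed W S phi -> #|phi @: W| = #|W|.
Proof. by case/andP => /dinjectiveP h _; rewrite card_in_imset. Qed.

Lemma placed_update W S phi u z : u \notin W ->
  placed (u |: W)%SET S (update phi u z) =
  placed W S phi && (z \in S :\: phi @: W)%SET.
Proof.
move=> uW.
have upd a : a \in W -> update phi u z a = phi a.
  by move=> aW; rewrite ffunE; case: eqP => // e; rewrite -e aW in uW.
have updu : update phi u z u = z by rewrite ffunE eqxx.
rewrite inE; apply/andP/idP => [[/dinjectiveP hinj /fintype.subsetP hS]|].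
  apply/andP; split; [apply/andP; split|apply/andP; split].
  - apply/dinjectiveP => a b aW bW e; apply: hinj; rewrite ?inE ?aW ?bW ?orbT //.
    by rewrite !upd.
  - apply/fintype.subsetP => _ /imsetP[a aW ->]; rewrite -(upd a aW).
    by apply: hS; apply: imset_f; rewrite !inE aW orbT.
  - apply/negP => /imsetP[a aW e]; case/negP: uW.
    by rewrite (hinj u a) ?inE ?eqxx ?aW ?orbT // updu upd.
  - by rewrite -updu; apply: hS; apply: imset_f; rewrite !inE eqxx.
move=> /andP[/andP[/dinjectiveP hinj /fintype.subsetP hS] /andP[zW zS]]; split.
  apply/dinjectiveP => a b; rewrite !inE.
  move=> /orP[/eqP->|aW] /orP[/eqP->|bW] //; rewrite ?updu ?upd //.
  - by move=> e; case/negP: zW; rewrite e imset_f.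
  - by move=> e; case/negP: zW; rewrite -e imset_f.
  - exact: hinj.
apply/fintype.subsetP => _ /imsetP[a + ->]; rewrite !inE => /orP[/eqP->|aW].
  by rewrite updu.
by rewrite upd //; apply: hS; apply: imset_f.
Qed.

Lemma edge_prod_update r g W phi u x z :
  symmetric r -> irreflexive r -> (forall i j, g i j = g j i) ->
  u \notin W -> x \in W -> r u x -> (forall y, y \in W -> r u y -> y = x) ->
  edge_prod r g (u |: W)%SET (update phi u z) =
  edge_prod r g W phi * (g (phi x) z)%:R.
Proof.
move=> rsym rirr gsym uW xW rux uniqx.
have upd a : a \in W -> update phi u z a = phi a.
  by move=> aW; rewrite ffunE; case: eqP => // e; rewrite -e aW in uW.
have updu : update phi u z u = z by rewrite ffunE eqxx.
rewrite /edge_prod (edge_set_leaf rsym rirr uW xW) // big_setU1 ?sort_pairNedge //=.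
rewrite mulrC; congr (_ * _).
  by apply: eq_bigr => -[a b]; rewrite inE => /and4P[/= aW bW _ _]; rewrite !upd.
by rewrite /sort_pair; case: ifP => _ /=; rewrite updu upd // gsym.
Qed.

(** The maps on the left already have a value at [u]; the factor [n] lets it be redrawn as [z]. *)
Lemma placements_leaf r g W S u x :
  symmetric r -> irreflexive r -> (forall i j, g i j = g j i) ->
  u \notin W -> x \in W -> r u x -> (forall y, y \in W -> r u y -> y = x) ->
  n%:R * placements r g (u |: W)%SET S =
  \sum_(phi | placed W S phi)
     edge_prod r g W phi * \sum_(z in (S :\: phi @: W)%SET) (g (phi x) z)%:R.
Proof.
move=> rsym rirr gsym uW xW rux uniqx.
rewrite /placements big_mkcond -(sum_update _ u) [RHS]big_mkcond.
apply: eq_bigr => phi _; case: ifP => hphi; last first.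
  by rewrite big1 // => z _; rewrite placed_update // hphi.
rewrite mulr_sumr [RHS]big_mkcond; apply: eq_bigr => z _.
by rewrite placed_update // hphi /=; case: ifP => // _; exact: edge_prod_update.
Qed.

End Placements.

(** * The error made in attaching one leaf, and second moments of rooted counts *)

Section LeafRemoval.
Variables (R : realType) (T : finType) (r : rel T) (n : nat) (p : R).
Hypotheses (rsym : symmetric r) (rirr : irreflexive r).
Hypotheses (n0 : (0 < n)%N) (p0 : 0 < p) (p1 : p <= 1).
Implicit Types (W J C : {set T}) (S : {set 'I_n}) (phi psi : {ffun T -> 'I_n}).
Implicit Types (c : {ffun upair n -> bool}) (u x : T) (y : 'I_n).

Let N0 : 0 < n%:R :> R. Proof. by rewrite ltr0n. Qed.
Let N0w : 0 <= n%:R :> R. Proof. exact: ltW. Qed.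
Let p0w : 0 <= p. Proof. exact: ltW. Qed.

(** Since values outside [W] are free, this is the number of copies in [S] of the graph on [W],
    divided by n^|W| p^(e(W)). *)
Definition density c W S : R :=
  p ^- #|edge_set r W| * (n%:R ^- #|T| * placements R r (config_graph c) W S).

(** The summand |T| accounts for the vertices already occupied by a copy, each of which changes the
    count by at most 1. *)
Definition relative_deviation c S y : R :=
  (`|deviation p c S y| + #|T|%:R) / (p * n%:R).

(** Placements range over all of [n], so that [S] enters through the deviation alone. *)
Definition leaf_error c W x S : R :=
  p ^- #|edge_set r W| * (n%:R ^- #|T| *
  \sum_(phi | placed W [set: 'I_n]%SET phi)
     edge_prod R r (config_graph c) W phi * relative_deviation c S (phi x)).

Lemma density_leaf c W S u x :
  u \notin W -> x \in W -> r u x -> (forall a, a \in W -> r u a -> a = x) ->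
  `|density c (u |: W)%SET S - (#|S|%:R - #|W|%:R) / n%:R * density c W S|
    <= leaf_error c W x S.
Proof.
move=> uW xW rux uniqx; set g := config_graph c.
have gsym i j : g i j = g j i by exact: config_graphC.
have Hleaf := @placements_leaf R T n r g W S u x rsym rirr gsym uW xW rux uniqx.
pose D := \sum_(phi | placed W S phi) edge_prod R r g W phi *
   \sum_(z in (S :\: phi @: W)%SET) ((g (phi x) z)%:R - p).
(* Every placement leaves exactly |S| - |W| positions for [u], so centring each of them at [p]
   removes precisely the main term. *)
have HD : n%:R * placements R r g (u |: W)%SET S - p * (#|S|%:R - #|W|%:R) *
    placements R r g W S = D.
  rewrite Hleaf /placements mulr_sumr -sumrB; apply: eq_bigr => phi hphi.
  rewrite big_split /= sumr_const [RHS]mulrDr; congr (_ + _).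
  have /andP[_ sS] := hphi.
  rewrite cardsD (finset.setIidPr sS) (placed_card hphi) -[_ *+ (_ - _)]mulr_natr natrB; first ring.
  by rewrite -(placed_card hphi) subset_leq_card.
have -> : density c (u |: W)%SET S - (#|S|%:R - #|W|%:R) / n%:R * density c W S =
    p ^- #|edge_set r W| * (n%:R ^- #|T| * (D / (p * n%:R))).
  rewrite -HD /density (card_edge_set_leaf rsym rirr uW xW) // exprS; field.
  by rewrite !expf_neq0 ?gt_eqF.
rewrite !normrM !(gtr0_norm (_ : 0 < _ ^- _)) ?invr_gt0 ?exprn_gt0 //.
rewrite /leaf_error ler_wpM2l ?invr_ge0 ?exprn_ge0 // ler_wpM2l ?invr_ge0 ?exprn_ge0 //.
rewrite (gtr0_norm (_ : 0 < (p * _)^-1)) ?invr_gt0 ?mulr_gt0 //.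
rewrite ler_pdivrMr ?mulr_gt0 // mulr_suml.
apply: le_trans (ler_norm_sum _ _ _) _.
apply: (@le_trans _ _ (\sum_(phi | placed W S phi) edge_prod R r g W phi *
   (`|deviation p c S (phi x)| + #|T|%:R))); last first.
  rewrite big_mkcond [leRHS]big_mkcond; apply: ler_sum => phi _.
  rewrite /relative_deviation -mulrA divfK ?mulf_neq0 ?gt_eqF //.
  case: ifP => [/andP[h _]|_].
    by rewrite /placed h finset.subsetT.
  by case: ifP => // _; rewrite mulr_ge0 ?edge_prod_ge0 ?addr_ge0.
apply: ler_sum => phi hphi; rewrite normrM ger0_norm ?edge_prod_ge0 //.
rewrite ler_wpM2l ?edge_prod_ge0 //.
have /andP[_ sS] := hphi.
have -> : \sum_(z in (S :\: phi @: W)%SET) ((g (phi x) z)%:R - p) =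
   deviation p c S (phi x) - \sum_(z in phi @: W) ((g (phi x) z)%:R - p).
  rewrite /deviation [in RHS](big_setID (phi @: W)%SET) /= (finset.setIidPr sS); ring.
apply: le_trans (ler_normB _ _) _; rewrite lerD2l.
apply: le_trans (ler_norm_sum _ _ _) _.
apply: (@le_trans _ _ (\sum_(z in phi @: W) 1)).
  apply: ler_sum => z _; rewrite ler_norml.
  by case: (g _ _) => /=; apply/andP; split; move: (ltW p0) p1; lra.
rewrite sumr_const ler_nat (placed_card hphi); exact: max_card.
Qed.

(** The factor [n] compensates for fixing the image of [x]: the average over [y] is [density] at the
    full vertex set. *)
Definition rooted_density c W x y : R :=
  n%:R * (p ^- #|edge_set r W| * (n%:R ^- #|T| *
  \sum_(phi | placed W [set: 'I_n]%SET phi && (phi x == y))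
     edge_prod R r (config_graph c) W phi)).

Definition second_moment c W x : R := n%:R^-1 * \sum_y rooted_density c W x y ^+ 2.

(** AM-GM is weighted because the two averages differ in kind: the second moment is merely bounded
    and gets the small weight [th], while the deviations can be made small once [th] is fixed. *)
Lemma leaf_error_le (th : R) c W x S : 0 < th ->
  leaf_error c W x S <= th * second_moment c W x +
    th^-1 * (n%:R^-1 * \sum_y relative_deviation c S y ^+ 2).
Proof.
move=> th0.
have -> : leaf_error c W x S =
    n%:R^-1 * \sum_y rooted_density c W x y * relative_deviation c S y.
  rewrite /leaf_error (partition_big (fun phi : {ffun T -> 'I_n} => phi x) xpredT) //=.
  rewrite !mulr_sumr; apply: eq_bigr => y _; rewrite /rooted_density.
  rewrite (eq_bigr (fun phi => edge_prod R r (config_graph c) W phi * relative_deviation c S y)).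
    by rewrite -mulr_suml; field; rewrite !expf_neq0 ?gt_eqF.
  by move=> phi /andP[_ /eqP->].
rewrite /second_moment mulrCA [th^-1 * _]mulrCA -mulrDr ler_wpM2l ?invr_ge0 //.
rewrite !mulr_sumr -big_split /=; apply: ler_sum => y _.
set a := rooted_density _ _ _ _; set b := relative_deviation _ _ _.
have : 0 <= th^-1 * ((th * a - b) ^+ 2 + (th * a) ^+ 2 + b ^+ 2).
  by rewrite mulr_ge0 ?invr_ge0 ?(ltW th0) // !addr_ge0 ?sqr_ge0 //.
have -> : th^-1 * ((th * a - b) ^+ 2 + (th * a) ^+ 2 + b ^+ 2) =
    2 * (th * a ^+ 2 + th^-1 * b ^+ 2 - a * b) by field; rewrite gt_eqF.
by rewrite pmulr_rge0 // subr_ge0.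
Qed.

(** Two norms are mixed: D^2 <= 7 p n |D| by the degree bound, and the sum of |D| is at most lam p
    n^2. With (a + b)^2 <= 2 a^2 + 2 b^2 this gives 14 lam. *)
Lemma mean_relative_deviation_le (lam : R) c S : 0 <= lam ->
  ~~ uneven_cut p lam c -> ~~ dense_star p c ->
  n%:R^-1 * \sum_y relative_deviation c S y ^+ 2 <=
    14 * lam + 2 * #|T|%:R ^+ 2 / (p * n%:R) ^+ 2.
Proof.
move=> l0 hcut hstar; have p01 : 0 <= p <= 1 by rewrite ltW.
have pn0 : 0 < p * n%:R by rewrite mulr_gt0.
have N1 : n%:R != 0 :> R by rewrite gt_eqF.
have P1 : p != 0 by rewrite gt_eqF.
have hsum := sum_deviation_le S hcut.
apply: (@le_trans _ _ (n%:R^-1 * \sum_(y < n)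
   (2 * (7 * (p * n%:R)) * `|deviation p c S y| + 2 * #|T|%:R ^+ 2) / (p * n%:R) ^+ 2)).
  rewrite ler_wpM2l ?invr_ge0 //; apply: ler_sum => y _.
  rewrite /relative_deviation exprMn exprVn ler_wpM2r ?invr_ge0 ?exprn_ge0 ?(ltW pn0) //.
  have h := deviation_le p01 S y hstar.
  set D := `|_| in h *; have D0 : 0 <= D by exact: normr_ge0.
  have hD : D * D <= 7 * (p * n%:R) * D by rewrite ler_wpM2r.
  by have := sqr_ge0 (D - #|T|%:R : R); lra.
rewrite -mulr_suml big_split /= -mulr_sumr sumr_const card_ord -[(_ * _) *+ n]mulr_natr.
rewrite [leLHS]mulrA ler_pdivrMr ?exprn_gt0 //.
have -> : (14 * lam + 2 * #|T|%:R ^+ 2 / (p * n%:R) ^+ 2) * (p * n%:R) ^+ 2 =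
  n%:R^-1 * (2 * (7 * (p * n%:R)) * (lam * p * n%:R ^+ 2) + 2 * #|T|%:R ^+ 2 * n%:R).
  by field; apply/andP.
rewrite ler_wpM2l ?invr_ge0 // lerD2r ler_wpM2l //.
by rewrite !mulr_ge0.
Qed.

(** Up to constants, every nonempty part of [W] has in expectation at least one copy through a given
    vertex. *)
Definition balanced W := forall J, J \subset W -> J != finset.set0 ->
  1 <= n%:R ^+ #|J|.-1 * p ^+ #|edge_set r J|.

Definition overlap W phi psi : {set T} := [set a in W | psi a \in phi @: W]%SET.

(* Two placements share at most the edges inside their overlap. *)
Lemma expect_edge_prod2 W phi psi :
  {in W &, injective phi} -> {in W &, injective psi} ->
  expect p (fun c => edge_prod R r (config_graph c) W phi *
                     edge_prod R r (config_graph c) W psi) <=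
  p ^+ #|edge_set r W| * (p ^+ #|edge_set r W| * p ^- #|edge_set r (overlap W phi psi)|).
Proof.
move=> phi_inj psi_inj; set J := overlap W phi psi; have p01 : 0 <= p <= 1 by rewrite ltW.
have sJ : J \subset W by apply/fintype.subsetP => a; rewrite inE => /andP[].
pose E := edge_set r W; pose E' := (edge_set r W :\: edge_set r J)%SET.
(* The flag separates the edges of [phi] from those of [psi] outside the overlap. No pair of
   vertices is hit twice: an edge of [psi] landing on one of [phi] has both ends in [J], and edges
   inside [J] are dropped from the second copy as factors at most 1. *)
pose A := [set k : bool * (T * T) | k.2 \in (if k.1 then E else E')]%SET.
pose f (k : bool * (T * T)) : 'I_n * 'I_n :=
  if k.1 then (phi k.2.1, phi k.2.2) else (psi k.2.1, psi k.2.2).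
pose o k := upair_of (f k).1 (f k).2.
have prodA (h : bool * (T * T) -> R) : \prod_(k in A) h k =
    (\prod_(ab in E) h (true, ab)) * (\prod_(ab in E') h (false, ab)).
  transitivity (\prod_(k | xpredT k.1 && (k.2 \in (if k.1 then E else E'))) h (k.1, k.2)).
    by apply: eq_big => [k|k _]; rewrite ?inE -?surjective_pairing.
  rewrite -(pair_big_dep xpredT (fun b ab => ab \in (if b then E else E')) (fun b ab => h (b, ab))) /=.
  by rewrite big_bool.
have fA k : k \in A -> exists2 ab, ab \in E &
    k.2 = ab /\ (ab.1 != ab.2).
  rewrite inE => kA; exists k.2; first by move: kA; case: k.1 => //; rewrite inE => /andP[].
  split => //; have : k.2 \in E by move: kA; case: k.1 => //; rewrite inE => /andP[].
  rewrite inE => /and4P[_ _ _]; apply: contraTneq => ->; by rewrite ltnn.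
have oN k : k \in A -> o k != None.
  move=> kA; have [ab + [e ne]] := fA _ kA; rewrite inE => /and4P[aW bW _ _].
  apply: upair_of_neq; rewrite /f e; case: k.1 => /=; apply: contra_neq ne.
    exact: phi_inj.
  exact: psi_inj.
have mixed ab cd : ab \in E -> cd \in E' ->
    upair_of (phi ab.1) (phi ab.2) = upair_of (psi cd.1) (psi cd.2) -> False.
  rewrite !inE => /and4P[aW bW _ lab] /andP[nJ /and4P[cW dW hr hl]].
  move: nJ; rewrite hr hl !andbT cW dW /= => nJ e.
  have ne : phi ab.1 != phi ab.2.
    by apply: contraTneq lab => /phi_inj -> //; rewrite ltnn.
  case/negP: nJ; case: (upair_of_inj ne e) => [[<- <-]|[<- <-]];
  by apply/andP; split; apply: imset_f.
have same (eta : {ffun T -> 'I_n}) ab cd : {in W &, injective eta} -> ab \in E -> cd \in E ->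
    upair_of (eta ab.1) (eta ab.2) = upair_of (eta cd.1) (eta cd.2) -> ab = cd.
  move=> eta_inj; rewrite !inE => /and4P[aW bW _ lab] /and4P[cW dW _ lcd] e.
  have ne : eta ab.1 != eta ab.2.
    by apply: contraTneq lab => /eta_inj -> //; rewrite ltnn.
  case: (upair_of_inj ne e) => [[/eta_inj e1 /eta_inj e2]|[/eta_inj e1 /eta_inj e2]].
    by case: ab cd aW bW e1 e2 cW dW {e ne lab lcd} => [a b] [k l] /= aW bW e1 e2 cW dW; rewrite (e1 aW cW) (e2 bW dW).
  by move: lab; rewrite (e1 aW dW) (e2 bW cW) ltnNge ltnW.
have oinj : {in A &, injective o}.
  move=> [b ab] [b' cd]; rewrite !inE /= /o /f.
  have EE' q : q \in E' -> q \in E by rewrite inE => /andP[].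
  case: b; case: b' => /= hab hcd e.
  - by rewrite (same phi ab cd).
  - by have := mixed _ _ hab hcd e.
  - by have := mixed _ _ hcd hab (esym e).
  - by rewrite (same psi ab cd) ?EE'.
apply: (@le_trans _ _ (expect p (fun c => \prod_(k in A) ((oapp c false (o k))%:R : R)))).
  apply: le_expect => // c; rewrite prodA /=.
  rewrite ler_wpM2l ?edge_prod_ge0 //.
  rewrite /edge_prod (big_setID (edge_set r J)) /= -[leRHS]mul1r ler_wpM2r ?prodr_ge0 //.
  by apply: prodr_ile1 => ab _; case: (config_graph _ _ _) => /=; rewrite ?lexx ler01.
rewrite expect_all // -prodr_const prodA !prodr_const.
rewrite ler_wpM2l ?exprn_ge0 // cardsD (finset.setIidPr (edge_setS r sJ)).
by rewrite exprB ?subset_leq_card ?edge_setS // unitfE gt_eqF.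
Qed.

(** The weight is a product over [a], so the sum factorizes. In each factor the at most |T| values
    in the image of [phi] contribute [n] each, and all others together at most [n]. *)
Lemma sum_overlap_le W phi :
  \sum_psi n%:R ^+ #|overlap W phi psi| <=
  ((#|T|.+1)%:R * n%:R) ^+ #|T| :> R.
Proof.
have -> : \sum_psi n%:R ^+ #|overlap W phi psi| =
   \sum_(psi : {ffun T -> 'I_n}) \prod_a
     (if (a \in W) && (psi a \in phi @: W) then n%:R else 1) :> R.
  apply: eq_bigr => psi _; rewrite -prodr_const big_mkcond.
  by apply: eq_bigr => a _; rewrite inE.
rewrite -(bigA_distr_bigA (fun a z => if (a \in W) && (z \in phi @: W) then n%:R else 1)) /=.
rewrite -[#|T|]/(#|{: T}|) -prodr_const; apply: ler_prod => a _; apply/andP; split.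
  by apply: sumr_ge0 => z _; case: ifP.
apply: (@le_trans _ _ (\sum_(z < n) ((if z \in phi @: W then n%:R else 0) + 1))).
  apply: ler_sum => z _; case: (a \in W) => /=; last by case: ifP; rewrite ?lerDr ?add0r.
  by case: ifP => _; rewrite ?lerDl ?add0r.
rewrite big_split /= -big_mkcond /= !sumr_const card_ord.
apply: (@le_trans _ _ ((#|phi @: W|.+1)%:R * n%:R)).
  by rewrite -natr1 mulrDl mul1r mulr_natl.
rewrite ler_wpM2r // ler_nat ltnS.
exact: leq_trans (leq_imset_card _ _) (max_card _).
Qed.

(** Equal roots put [x] into the overlap [J], so balance applies and trades p^(- e(J)) for n^(|J| -
    1). The missing factor [n] cancels the one in the normalization of the rooted counts. *)
Lemma expect_second_moment W x : x \in W -> balanced W ->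
  expect p (fun c => second_moment c W x) <= (#|T|.+1)%:R ^+ #|T|.
Proof.
move=> xW bal; have p01 : 0 <= p <= 1 by rewrite ltW.
set e := #|edge_set r W|; pose full := [set: 'I_n]%SET.
pose pairOK (q : {ffun T -> 'I_n} * {ffun T -> 'I_n}) :=
  [&& placed W full q.1, placed W full q.2 & q.1 x == q.2 x].
pose ep c phi := edge_prod R r (config_graph c) W phi.
pose K : R := n%:R * (p ^- e * n%:R ^- #|T|) ^+ 2.
have E1 c : second_moment c W x =
    K * \sum_(q | pairOK q) ep c q.1 * ep c q.2.
  rewrite /second_moment /K.
  transitivity (n%:R^-1 * \sum_y n%:R ^+ 2 * (p ^- e * n%:R ^- #|T|) ^+ 2 *
     \sum_(q | pairOK q && (q.1 x == y)) ep c q.1 * ep c q.2).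
    congr (_ * _); apply: eq_bigr => y _; rewrite /rooted_density.
    set s := \sum_(phi | _) _.
    have -> : \sum_(q | pairOK q && (q.1 x == y)) ep c q.1 * ep c q.2 = s ^+ 2.
      rewrite expr2 /s big_distrlr /= pair_big /=; apply: eq_bigl => -[phi psi].
      rewrite /pairOK /=; case: (placed _ _ phi); case: (placed _ _ psi) => //=.
        by apply/andP/andP => [[/eqP -> ->]|[/eqP -> /eqP ->]] //; rewrite !eqxx.
      by rewrite andbF.
    by rewrite -/e; ring.
  rewrite -mulr_sumr [in RHS](partition_big (fun q : {ffun T -> 'I_n} * {ffun T -> 'I_n} => q.1 x) xpredT) //=.
  by field; rewrite !expf_neq0 ?gt_eqF.
rewrite (eq_expect p E1) expectZ (expect_sum p).
apply: (@le_trans _ _ (K * \sum_phi \sum_psi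
    (p ^+ e) ^+ 2 * n%:R^-1 * n%:R ^+ #|overlap W phi psi|)).
  rewrite ler_wpM2l //; first by rewrite mulr_ge0 ?sqr_ge0.
  rewrite [leRHS]pair_big [leLHS]big_mkcond /=; apply: ler_sum => -[phi psi] _ /=.
  set J := overlap W phi psi.
  case: ifP => [/and3P[/= /andP[/dinjectiveP i1 _] /andP[/dinjectiveP i2 _] /eqP exy]|_]; last first.
    by rewrite !mulr_ge0 ?sqr_ge0 ?invr_ge0 ?exprn_ge0.
  apply: le_trans (expect_edge_prod2 i1 i2) _; rewrite -/J -/e.
  have xJ : x \in J by rewrite inE xW -exy imset_f.
  have sJ : J \subset W by apply/fintype.subsetP => a; rewrite inE => /andP[].
  have J0 : J != finset.set0 by apply/set0Pn; exists x.
  have := bal J sJ J0; set eJ := #|edge_set r J| => hJ.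
  rewrite mulrA -expr2 -mulrA ler_wpM2l ?sqr_ge0 //.
  have cJ : (0 < #|J|)%N by rewrite card_gt0.
  rewrite -[#|J|](prednK cJ) exprS mulKf ?gt_eqF //.
  by rewrite -[leLHS]mul1r ler_pdivrMr ?exprn_gt0.
apply: (@le_trans _ _ (K * \sum_(phi : {ffun T -> 'I_n}) (p ^+ e) ^+ 2 * n%:R^-1 *
   ((#|T|.+1)%:R * n%:R) ^+ #|T|)).
  rewrite ler_wpM2l //; first by rewrite mulr_ge0 ?sqr_ge0.
  apply: ler_sum => phi _; rewrite -mulr_sumr ler_wpM2l ?sum_overlap_le //.
  by rewrite mulr_ge0 ?sqr_ge0 ?invr_ge0.
rewrite sumr_const card_ffun card_ord -[_ *+ _]mulr_natl natrX exprMn /K.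
rewrite le_eqVlt; apply/orP; left; apply/eqP; field.
by rewrite !expf_neq0 ?gt_eqF.
Qed.

End LeafRemoval.

(** * Iteration over the leaves and the exceptional event of large second moments *)

Section Assembly.
Variables (R : realType) (T : finType) (r : rel T) (n : nat) (p : R).
Hypotheses (rsym : symmetric r) (rirr : irreflexive r).
Hypotheses (n0 : (0 < n)%N) (p0 : 0 < p) (p1 : p <= 1).
Implicit Types (W J C V : {set T}) (S : {set 'I_n}).
Implicit Types (c : {ffun upair n -> bool}).

Let N0 : 0 < n%:R :> R. Proof. by rewrite ltr0n. Qed.

Lemma peel_sub C W : peel r C W -> C \subset W.
Proof.
elim=> // {}W u x _ sCW _ _ _ _.
exact: fintype.subset_trans sCW (finset.subsetUr _ _).
Qed.

(** One leaf multiplies the earlier error by (|S| - |W|) / n and adds a new one. The factor is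
    negative when [S] is small, so its absolute value is bounded, by 1 + |T|; the successive factors
    build up [falling]. *)
Lemma density_peel C V c S (eps : R) : 0 <= eps ->
  (forall W x, W \subset V -> x \in W -> leaf_error r p c W x S <= eps) ->
  forall W, peel r C W -> W \subset V ->
  `|density r p c W S - n%:R ^- (#|W| - #|C|) *
      falling (#|S|%:R - #|C|%:R) (#|W| - #|C|) * density r p c C S| <=
  (#|W| - #|C|)%:R * (1 + #|T|%:R) ^+ (#|W| - #|C|) * eps.
Proof.
move=> eps0 herr W; elim=> [_|{}W u x pW IH uW xW rux uniqx sV].
  by rewrite subnn /falling big_ord0 expr0 invr1 !mul1r subrr normr0 !mul0r.
have sWV : W \subset V by apply: fintype.subset_trans sV; exact: finset.subsetUr.
have leCW : (#|C| <= #|W|)%N by apply: subset_leq_card; exact: peel_sub pW.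
rewrite cardsU1 uW add1n subSn //; move: (IH sWV); set m := (#|W| - #|C|)%N => {}IH.
have eW : #|W|%:R = #|C|%:R + m%:R :> R by rewrite -natrD /m subnKC.
set a : R := (#|S|%:R - #|W|%:R) / n%:R.
have ha : `|a| <= 1 + #|T|%:R.
  rewrite /a normrM normfV (gtr0_norm N0) ler_pdivrMr //.
  apply: le_trans (ler_normB _ _) _; rewrite !normr_nat mulrDl mul1r lerD //.
    by rewrite ler_nat -[leqRHS]card_ord max_card.
  apply: (@le_trans _ _ (#|T|%:R * 1)); first by rewrite mulr1 ler_nat max_card.
  by rewrite ler_wpM2l // ler1n.
set X := falling _ m in IH; set Q := density r p c C S in IH *.
have -> : density r p c (u |: W)%SET S -
    n%:R ^- m.+1 * falling (#|S|%:R - #|C|%:R) m.+1 * Q =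
  (density r p c (u |: W)%SET S - a * density r p c W S) +
  a * (density r p c W S - n%:R ^- m * X * Q).
  rewrite /falling big_ord_recr /= -/(falling _ m) -/X /a eW exprS; field.
  by rewrite !expf_neq0 ?gt_eqF.
apply: le_trans (ler_normD _ _) _.
have h1 := le_trans (density_leaf rsym rirr n0 p0 p1 c S uW xW rux uniqx) (herr _ _ sWV xW).
apply: (le_trans (lerD h1 (lexx _))); rewrite normrM.
apply: (@le_trans _ _ (eps + (1 + #|T|%:R) * (m%:R * (1 + #|T|%:R) ^+ m * eps))).
  by rewrite lerD2l ler_pM.
have -> : m.+1%:R * (1 + #|T|%:R) ^+ m.+1 * eps = (1 + #|T|%:R) ^+ m.+1 * eps +
    (1 + #|T|%:R) * (m%:R * (1 + #|T|%:R) ^+ m * eps) by rewrite -natr1 exprS; ring.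
by rewrite lerD2r -[leLHS]mul1r ler_wpM2r // exprn_ege1 // lerDl.
Qed.

Lemma balanced_peel C W : peel r C W -> 1 <= p * n%:R ->
  balanced r n p C -> balanced r n p W.
Proof.
move=> pW hpn bC; elim: pW => // {}W u x pW IH uW xW rux uniqx J sJ J0.
have [uJ|uJ] := boolP (u \in J); last first.
  apply: IH => //; apply/fintype.subsetP => a aJ.
  have := fintype.subsetP sJ _ aJ; rewrite !inE => /orP[/eqP e|//].
  by rewrite -e aJ in uJ.
have cJ : #|J| = #|J :\ u|.+1 by rewrite [LHS](cardsD1 u) uJ.
have sJW : (J :\ u)%SET \subset W.
  apply/fintype.subsetP => a; rewrite !inE => /andP[au aJ].
  by have := fintype.subsetP sJ _ aJ; rewrite !inE (negbTE au).
(* When [J] is the leaf alone, the truncated exponent gains no factor [n], but there is no edge to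
   pay for either. *)
have [JE|J1] := eqVneq (J :\ u)%SET finset.set0.
  have hJ : #|J| = 1%N by rewrite cJ JE cards0.
  have : (2 * #|edge_set r J| <= 0 * #|J|)%N.
    apply: handshake_le => // a aJ; rewrite leqn0 cards_eq0; apply/eqP/setP => b.
    have /cards1P[z ez] : #|J| == 1%N by rewrite hJ.
    move: aJ; rewrite !inE ez !inE => /eqP->; case: eqP => // ->.
    by rewrite rirr.
  by rewrite mul0n leqn0 muln_eq0 /= => /eqP->; rewrite hJ expr0 mul1r.
have := IH _ sJW J1; rewrite cJ /=.
have : (0 < #|J :\ u|)%N by rewrite card_gt0.
case: #|J :\ u| => // k _ /=.
have := card_edge_set_leaf_sub rsym rirr uW xW rux uniqx sJ.
move=> /(ler_wiXn2l (ltW p0) p1) he hk.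
apply: (@le_trans _ _ (n%:R ^+ k.+1 * p ^+ #|edge_set r (J :\ u)|.+1)); last first.
  by rewrite ler_wpM2l ?exprn_ge0 // ltW.
have -> : n%:R ^+ k.+1 * p ^+ #|edge_set r (J :\ u)|.+1 =
  (n%:R ^+ k * p ^+ #|edge_set r (J :\ u)|) * (p * n%:R) by rewrite !exprS; ring.
by rewrite mulr_ege1.
Qed.

(* With [D] the maximum degree of the core, [p >> (n ln n)^(-1/D)] gives
   [p^(3D) n^4 >= n / (ln n)^3 >= 1] eventually: this integral form of the
   threshold is all that the overlap count needs. *)
Lemma balance_arith (D j e : nat) : 1 <= p * n%:R -> 1 <= p ^+ (3 * D) * n%:R ^+ 4 ->
  (0 < j)%N -> (2 * e <= minn D j.-1 * j)%N -> 1 <= n%:R ^+ j.-1 * p ^+ e.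
Proof.
move=> hpn hD; case: j => [//|[|[|j]]] _ /= hj.
- by move: hj; rewrite minn0 mul0n leqn0 muln_eq0 /= => /eqP->; rewrite expr0 mul1r.
- have : (e <= 1)%N.
    rewrite -(leq_pmul2l (isT : (0 < 2)%N)); apply: leq_trans hj _.
    by rewrite mulnC leq_mul2l /= geq_minr.
  move=> /(ler_wiXn2l (ltW p0) p1); rewrite !expr1 => he.
  apply: le_trans hpn _; rewrite mulrC ler_wpM2l //; exact: ltW.
(* The case of j + 3 vertices. Sixth powers turn e <= D (j + 3) / 2 into j + 3 factors p^(3 D); each
   is paired with n^4, and n^(6 (j + 2)) leaves a surplus n^(2 j). *)
- have he : (6 * e <= 3 * D * j.+3)%N.
    rewrite -[6%N]/(3 * 2)%N -!mulnA leq_mul2l /=; apply: leq_trans hj _.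
    by rewrite leq_mul2r geq_minl orbT.
  have x0 : 0 <= n%:R ^+ j.+2 * p ^+ e.
    exact: mulr_ge0 (exprn_ge0 _ (ltW N0)) (exprn_ge0 _ (ltW p0)).
  rewrite -(@expr_ge1 _ 6) //.
  rewrite exprMn -!exprM [(e * 6)%N]mulnC.
  apply: (@le_trans _ _ (n%:R ^+ (j.+2 * 6) * p ^+ (3 * D * j.+3))); last first.
    by rewrite ler_wpM2l ?exprn_ge0 ?(ltW N0) // ler_wiXn2l // ltW.
  have -> : (j.+2 * 6 = 2 * j + 4 * j.+3)%N by lia.
  rewrite exprD -mulrA [n%:R ^+ (4 * _)]exprM [p ^+ (_ * j.+3)]exprM -exprMn.
  by rewrite mulr_ege1 ?exprn_ege1 ?ler1n // mulrC.
Qed.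

Lemma balanced_two_core (H K : sgraph T) : r =2 adj H -> is_two_core K H ->
  1 <= p * n%:R -> 1 <= p ^+ (3 * max_deg K) * n%:R ^+ 4 ->
  balanced r n p (verts K).
Proof.
move=> rH core hpn hD J sJ J0; apply: balance_arith hD _ _ => //.
  by rewrite card_gt0.
have := two_core_card_edge_set core sJ.
suff -> : edge_set r J = edge_set (adj H) J by [].
by apply/setP => ab; rewrite !inE rH.
Qed.

(** All subsets and roots are included, so that no order of peeling has to be fixed; their number
    depends on [T] alone. *)
Definition heavy_moment V (L : R) : pred {ffun upair n -> bool} := fun c =>
  [exists Wx : {set T} * T, [&& Wx.1 \subset V, Wx.2 \in Wx.1 &
     L < second_moment r p c Wx.1 Wx.2]].

Lemma heavy_moment_tail V (L : R) : 0 < L -> balanced r n p V ->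
  \sum_(c | heavy_moment V L c) weight p c <=
  (2 ^ #|T| * #|T| * #|T|.+1 ^ #|T|)%:R / L.
Proof.
move=> L0 bal; have p01 : 0 <= p <= 1 by rewrite ltW.
apply: le_trans (union_bound p01 (fun (Wx : {set T} * T) c =>
  [&& Wx.1 \subset V, Wx.2 \in Wx.1 & L < second_moment r p c Wx.1 Wx.2])) _.
have cT : #|{: {set T} * T}| = (2 ^ #|T| * #|T|)%N.
  by rewrite card_prod -[#|{: {set T}}|]cardsT -finset.powersetT card_powerset cardsT.
rewrite -cT natrM natrX -mulrA mulr_natl -sumr_const.
apply: ler_sum => -[W x] _ /=.
have [sW|] := boolP (W \subset V); last by rewrite big_pred0 // divr_ge0 ?exprn_ge0 // ltW.
have [xW|] := boolP (x \in W); last by rewrite big_pred0 // divr_ge0 ?exprn_ge0 // ltW.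
have balW : balanced r n p W.
  by move=> J sJ; apply: bal; exact: fintype.subset_trans sJ sW.
apply: (le_trans (weight_markov p01 (f := fun c => L^-1 * second_moment r p c W x) _ _)).
- move=> c; rewrite /second_moment !mulr_ge0 ?invr_ge0 ?(ltW L0) ?(ltW N0) //.
  by apply: sumr_ge0 => y _; exact: sqr_ge0.
- by move=> c /= h; rewrite mulrC ler_pdivlMr // mul1r ltW.
- by rewrite expectZ mulrC ler_wpM2r ?invr_ge0 ?(ltW L0) // expect_second_moment.
Qed.

End Assembly.

(** * Conclusion *)

Section Gap.
Variables (R : realType) (T : finType) (H K : sgraph T).
Hypotheses (cH : connected_graph H) (ntH : ~ is_tree H) (core : is_two_core K H).

Definition gap n (p : R) (g : 'I_n -> 'I_n -> bool) (S : {set 'I_n}) : R :=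
  (n%:R ^+ #|verts H|)^-1 *
  `| p ^- #|edges H| * (copies H S g)%:R
     - falling (#|S|%:R - #|verts K|%:R) (#|verts H| - #|verts K|) *
       p ^- #|edges K| * (copies K S g)%:R |.

(** As the core is induced, its copies use the same edges under [adj K] and [adj H], and both terms
    become densities for [adj H]. *)
Lemma gapE n (p : R) (c : {ffun upair n -> bool}) S : (0 < n)%N ->
  gap p (config_graph c) S =
  `| density (adj H) p c (verts H) S -
     n%:R ^- (#|verts H| - #|verts K|) *
     falling (#|S|%:R - #|verts K|%:R) (#|verts H| - #|verts K|) *
     density (adj H) p c (verts K) S |.
Proof.
move=> n0; have N0 : 0 < n%:R :> R by rewrite ltr0n.
have leKH : (#|verts K| <= #|verts H|)%N.
  by case: core => -[sKH _] _ _; exact: subset_leq_card.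
rewrite /density -(copies_placements R H S (config_graph c) n0).
have -> : placements R (adj H) (config_graph c) (verts K) S =
    placements R (adj K) (config_graph c) (verts K) S.
  apply: eq_bigr => phi _; rewrite /edge_prod (edge_set_two_core core) //.
rewrite -(copies_placements R K S (config_graph c) n0).
rewrite -(edge_set_two_core core) -!card_edges /gap.
rewrite -[X in X * _]gtr0_norm ?invr_gt0 ?exprn_gt0 // -normrM; congr `| _ |.
set m := (#|verts H| - #|verts K|)%N.
have -> : #|verts H| = (m + #|verts K|)%N by rewrite subnK.
rewrite exprD; set a := p ^- _; set b := p ^- _; field.
by rewrite !expf_neq0 ?gt_eqF.
Qed.

Lemma gap_le n (p : R) (c : {ffun upair n -> bool}) S (th lam L : R) :
  (0 < n)%N -> 0 < p -> p <= 1 -> 0 < th -> 0 <= lam -> 0 <= L ->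
  ~~ uneven_cut p lam c -> ~~ dense_star p c ->
  ~~ heavy_moment (adj H) p (verts H) L c ->
  gap p (config_graph c) S <= #|T|%:R * (1 + #|T|%:R) ^+ #|T| *
    (th * L + th^-1 * (14 * lam + 2 * #|T|%:R ^+ 2 / (p * n%:R) ^+ 2)).
Proof.
move=> n0 p0 p1 th0 l0 L0 hcut hstar hheavy; rewrite gapE //.
set eps := th * L + _.
have eps0 : 0 <= eps.
  have th0w := ltW th0; apply: addr_ge0; first exact: mulr_ge0.
  by rewrite mulr_ge0 ?invr_ge0 // addr_ge0 ?mulr_ge0 // ?invr_ge0 sqr_ge0.
have err (W : {set T}) x : W \subset verts H -> x \in W -> leaf_error (adj H) p c W x S <= eps.
  move=> sW xW; apply: (le_trans (leaf_error_le (adj H) n0 p0 c W x S th0)).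
  apply: lerD.
    rewrite ler_wpM2l ?(ltW th0) // leNgt.
    by have /existsPn/(_ (W, x)) := hheavy; rewrite /= sW xW.
  by rewrite ler_wpM2l ?invr_ge0 ?(ltW th0) //; exact: mean_relative_deviation_le.
have pHK := two_core_peel cH ntH core.
apply: (le_trans (density_peel (@adj_sym _ H) (@adj_irr _ H) n0 p0 p1 eps0 err pHK _)) => //.
have leT : (#|verts H| - #|verts K| <= #|T|)%N by rewrite (leq_trans (leq_subr _ _)) ?max_card.
rewrite ler_wpM2r // ler_pM ?exprn_ge0 ?addr_ge0 ?ler_nat //.
by rewrite ler_weXn2l // lerDl.
Qed.

Lemma sum_weight_le3 n (p : R) (A B C D : pred {ffun upair n -> bool}) :
  0 <= p <= 1 -> (forall c, A c -> [|| B c, C c | D c]) ->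
  \sum_(c | A c) weight p c <=
  \sum_(c | B c) weight p c + (\sum_(c | C c) weight p c + \sum_(c | D c) weight p c).
Proof.
move=> p01 sub.
have sumE (Q : pred {ffun upair n -> bool}) :
    \sum_(c | Q c) weight p c = \sum_c (if Q c then weight p c else 0).
  exact: big_mkcond.
rewrite !sumE -2!big_split /=; apply: ler_sum => c _.
have w0 := weight_ge0 p01 c; have := sub c.
by case: (A c); case: (B c); case: (C c); case: (D c) => /= h;
  rewrite ?addr0 ?add0r ?addr_ge0 ?lerDl ?addr_ge0 //; have := h isT.
Qed.

(** The fourth power of exp(x / 4) >= x / 4. It beats (p n)^3 in the degree bound and (ln n)^3 at
    the threshold. *)
Lemma expR_ge_pow4 (x : R) : 0 <= x -> x ^+ 4 / 256 <= expR x.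
Proof.
move=> x0; have -> : x = 4%:R * (x / 4) by field.
rewrite expRM_natl exprMn -[leLHS]mulrC mulrA.
have -> : 256^-1 * 4%:R ^+ 4 = 1 :> R by field.
rewrite mul1r lerXn2r ?nnegrE ?expR_ge0 ?divr_ge0 //.
by have := expR_ge1Dx (x / 4); lra.
Qed.

Lemma gap_tail (eps delta : R) : (0 < #|T|)%N -> 0 < eps -> 0 < delta ->
  exists Y : R, 0 < Y /\ forall n (p : R) (A : pred {ffun upair n -> bool}),
    (0 < n)%N -> 0 < p -> p <= 1 ->
    1 <= p ^+ (3 * max_deg K) * n%:R ^+ 4 -> n%:R <= (p * n%:R) ^+ 3 ->
    Y <= p * n%:R ->
    (forall c, A c -> exists S, eps < gap p (config_graph c) S) ->
    \sum_(c | A c) weight p c <= delta.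
Proof.
move=> T0 eps0 delta0.
pose t : R := #|T|%:R; have t0 : 0 < t by rewrite ltr0n.
pose B : R := t * (1 + t) ^+ #|T|.
have B0 : 0 < B by rewrite mulr_gt0 // exprn_gt0 // addr_gt0.
pose M : R := (2 ^ #|T| * #|T| * #|T|.+1 ^ #|T|)%:R.
have M0 : 0 < M by rewrite ltr0n !muln_gt0 T0 !expn_gt0.
(* [L] gives heavy moments probability at most delta / 2. Then [th] makes the second-moment term eps
   / 4, and [lam] the discrepancy term at most eps / 4; its cap 2 is the range of
   [uneven_cut_tail]. *)
pose L := 2 * M / delta; have L0 : 0 < L by rewrite divr_gt0 ?mulr_gt0.
pose th := eps / (4 * B * L); have th0 : 0 < th by rewrite divr_gt0 // mulr_gt0 // mulr_gt0.
pose lam : R := Num.min 2 (eps * th / (56 * B)).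
have lam0 : 0 < lam by rewrite lt_min ltr0n /= divr_gt0 // mulr_gt0.
(* Beyond p n >= 1, the summands serve in turn the term from occupied vertices, the hypothesis of
   [uneven_cut_tail], and n exp(- p n) <= 256 / (p n) <= delta / 4. *)
pose Y := 1 + 8 * B * t ^+ 2 / (th * eps) + 64 / lam ^+ 2 + 1024 / delta.
have Y2 : 0 < 8 * B * t ^+ 2 / (th * eps).
  by apply: divr_gt0; apply: mulr_gt0 => //; rewrite ?exprn_gt0 // mulr_gt0.
have Y3 : 0 < 64 / lam ^+ 2 by apply: divr_gt0; rewrite ?ltr0n ?exprn_gt0.
have Y4 : 0 < 1024 / delta by apply: divr_gt0; [rewrite ltr0n|exact: delta0].
exists Y; split; first by rewrite /Y; lra.
move=> n p A n0 p0 p1 hD hy3 hY hA; have p01 : 0 <= p <= 1 by rewrite ltW.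
set y := p * n%:R in hy3 hY *.
have N0 : 0 < n%:R :> R by rewrite ltr0n.
have y1 : 1 <= y by move: hY; rewrite /Y; lra.
have y2 : 8 * B * t ^+ 2 / (th * eps) <= y by move: hY; rewrite /Y; lra.
have y3 : 64 / lam ^+ 2 <= y by move: hY; rewrite /Y; lra.
have y4 : 1024 / delta <= y by move: hY; rewrite /Y; lra.
have y0 : 0 < y by lra.
have star_small : n%:R * expR (- y) <= delta / 4.
  rewrite expRN ler_pdivrMr ?expR_gt0 //.
  apply: (le_trans hy3); apply: (@le_trans _ _ (delta / 4 * (y ^+ 4 / 256))).
    have -> : delta / 4 * (y ^+ 4 / 256) = y ^+ 3 * (delta * y / 1024) by field.
    rewrite -[leLHS]mulr1 ler_wpM2l ?exprn_ge0 ?(ltW y0) //.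
    by move: y4; rewrite ler_pdivrMr // => ?; lra.
  by rewrite ler_wpM2l ?expR_ge_pow4 ?(ltW y0) // divr_ge0 // ltW.
have cut_small : expR (- n%:R) <= delta / 4.
  apply: le_trans star_small; rewrite -[leLHS]mul1r ler_pM ?expR_ge0 ?ler1n //.
  by rewrite ler_expR lerN2 /y -[leRHS]mul1r ler_wpM2r // ltW.
have bal : balanced (adj H) n p (verts H).
  apply: (balanced_peel (@adj_sym _ H) (@adj_irr _ H) p0 p1 (two_core_peel cH ntH core) y1).
  exact: (balanced_two_core n0 p0 p1 (fun _ _ => erefl) core y1 hD).
have final (c : {ffun upair n -> bool}) S : ~~ uneven_cut p lam c -> ~~ dense_star p c ->
    ~~ heavy_moment (adj H) p (verts H) L c -> gap p (config_graph c) S <= eps.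
  move=> h1 h2 h3.
  apply: (le_trans (gap_le S n0 p0 p1 th0 (ltW lam0) (ltW L0) h1 h2 h3)).
  rewrite -/t -/B -/y mulrDr [th^-1 * _]mulrDr mulrDr.
  have e1 : B * (th * L) = eps / 4 by rewrite /th; field; rewrite !gt_eqF.
  have e2 : B * (th^-1 * (14 * lam)) <= eps / 4.
    have hl : lam <= eps * th / (56 * B) by rewrite /lam ge_min lexx orbT.
    have -> : eps / 4 = B * (th^-1 * (14 * (eps * th / (56 * B)))).
      by field; rewrite !gt_eqF.
    by rewrite ler_wpM2l ?(ltW B0) // ler_wpM2l ?invr_ge0 ?(ltW th0) // ler_wpM2l.
  have e3 : B * (th^-1 * (2 * t ^+ 2 / y ^+ 2)) <= eps / 4.
    have -> : B * (th^-1 * (2 * t ^+ 2 / y ^+ 2)) =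
      eps / 4 * (8 * B * t ^+ 2 / (th * eps)) / y ^+ 2.
      by field; rewrite !gt_eqF.
    rewrite ler_pdivrMr ?exprn_gt0 // ler_wpM2l ?divr_ge0 ?(ltW eps0) //.
    by apply: (le_trans y2); rewrite expr2 -[leLHS]mul1r ler_wpM2r // ltW.
  by rewrite e1; lra.
apply: (@le_trans _ _ (\sum_(c : {ffun upair n -> bool} | uneven_cut p lam c) weight p c +
  (\sum_(c : {ffun upair n -> bool} | dense_star p c) weight p c +
   \sum_(c : {ffun upair n -> bool} | heavy_moment (adj H) p (verts H) L c) weight p c))).
  apply: sum_weight_le3 => // c Ac; have [S] := hA c Ac; rewrite ltNge.
  by apply: contraNT; rewrite !negb_or => /and3P[h1 h2 h3]; exact: final.
have hcut : \sum_(c : {ffun upair n -> bool} | uneven_cut p lam c) weight p c <= expR (- n%:R).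
  apply: uneven_cut_tail => //; first by rewrite lam0 /lam ge_min lexx.
  by move: y3; rewrite ler_pdivrMr ?exprn_gt0 // mulrC.
have hheavy : \sum_(c : {ffun upair n -> bool} | heavy_moment (adj H) p (verts H) L c) weight p c <= delta / 2.
  apply: (le_trans (heavy_moment_tail n0 p0 p1 L0 bal)).
  by rewrite -/M /L le_eqVlt; apply/orP; left; apply/eqP; field; rewrite !gt_eqF.
have := dense_star_tail n p01; rewrite -/y; lra.
Qed.

End Gap.

Local Open Scope classical_set_scope.
Local Open Scope ring_scope.

(** * Integral forms of the lower bound on the edge probability *)

Section Threshold.
Variables (R : realType) (p : nat -> R) (D : nat).
Hypotheses (p01 : forall n, 0 <= p n <= 1) (D2 : (2 <= D)%N).
Hypothesis hp : much_less (fun n => (n%:R * ln n%:R) `^ (- (D%:R)^-1)) p.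

Lemma threshold_near (Y : R) : 0 < Y -> \forall n \near \oo,
  [/\ (0 < n)%N, 0 < p n, 1 <= p n ^+ (3 * D) * n%:R ^+ 4,
      n%:R <= (p n * n%:R) ^+ 3 & Y <= p n * n%:R].
Proof.
move=> Y0; case: hp => pN0 /cvgrPdist_lt/(_ 1 ltr01) ratio.
near=> n.
(* The second summand makes ln n >= 256, so that n >= (ln n)^4 / 256 >= (ln n)^3; the first is
   compared with (p n)^3 >= n at the end. *)
have hn : Y ^+ 3 + expR 256 <= n%:R by near: n; exact: nbhs_infty_ger.
have e0 := expR_gt0 (256 : R).
have N0 : 0 < n%:R :> R by have := exprn_gt0 3 Y0; lra.
have n0 : (0 < n)%N by rewrite -(ltr0n R).
have pn0 : 0 < p n.
  by rewrite lt_neqAle eq_sym; case/andP: (p01 n) => -> _; rewrite andbT; near: n.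
have p1 : p n <= 1 by case/andP: (p01 n).
pose l : R := ln n%:R; have l256 : 256 <= l.
  by rewrite -ler_expR lnK ?posrE //; have := exprn_gt0 3 Y0; lra.
have l0 : 0 < l by lra.
have nl : l ^+ 3 <= n%:R.
  have := expR_ge_pow4 (ltW l0); rewrite lnK ?posrE //; apply: le_trans.
  have -> : l ^+ 4 / 256 = l ^+ 3 * (l / 256) by field.
  by rewrite -[leLHS]mulr1 ler_wpM2l ?exprn_ge0 ?(ltW l0) //; lra.
have nl0 : 0 < n%:R * l by rewrite mulr_gt0.
have lt_p : (n%:R * l) `^ (- (D%:R)^-1) < p n.
  have : `|0 - (n%:R * ln n%:R) `^ (- (D%:R)^-1) / p n| < 1 by near: n.
  by rewrite sub0r normrN ger0_norm ?divr_ge0 ?powR_ge0 ?(ltW pn0) // ltr_pdivrMr // mul1r.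
have D0 : D%:R != 0 :> R by rewrite pnatr_eq0 -lt0n (leq_trans _ D2).
have pD : (n%:R * l)^-1 <= p n ^+ D.
  have -> : (n%:R * l)^-1 = ((n%:R * l) `^ (- (D%:R)^-1)) ^+ D.
    rewrite -powR_mulrn ?powR_ge0 // -powRrM mulNr mulVf // powRN powRr1 //.
    exact: ltW.
  by rewrite lerXn2r ?nnegrE ?powR_ge0 ?(ltW pn0) ?(ltW lt_p).
have h4 : 1 <= p n ^+ (3 * D) * n%:R ^+ 4.
  rewrite mulnC exprM; apply: (@le_trans _ _ ((n%:R * l)^-1 ^+ 3 * n%:R ^+ 4)).
    have -> : (n%:R * l)^-1 ^+ 3 * n%:R ^+ 4 = n%:R / l ^+ 3.
      by field; rewrite !gt_eqF.
    by rewrite ler_pdivlMr ?exprn_gt0 // mul1r.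
  rewrite ler_wpM2r ?exprn_ge0 ?(ltW N0) // lerXn2r ?nnegrE ?invr_ge0 ?exprn_ge0 ?(ltW nl0) ?(ltW pn0) //.
have h3 : n%:R <= (p n * n%:R) ^+ 3.
  (* Here D >= 2 enters: p^6 >= p^(3 D), so p^6 n^4 >= 1, and its root p^3 n^2 >= 1 times [n] is the
     claim. *)
  have h6 : 1 <= (p n ^+ 3 * n%:R ^+ 2) ^+ 2.
    apply: (le_trans h4); rewrite exprMn -!exprM ler_wpM2r ?exprn_ge0 ?(ltW N0) //.
    by rewrite ler_wiXn2l ?(ltW pn0) // -[(3 * 2)%N]/(3 * 2)%N leq_mul2l.
  have h2 : 1 <= p n ^+ 3 * n%:R ^+ 2.
    by rewrite -(@expr_ge1 _ 2) // mulr_ge0 ?exprn_ge0 ?(ltW pn0) ?(ltW N0).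
  have -> : (p n * n%:R) ^+ 3 = (p n ^+ 3 * n%:R ^+ 2) * n%:R by ring.
  by rewrite -[leLHS]mul1r ler_wpM2r // ltW.
split => //; rewrite -(@ler_pXn2r _ 3) ?nnegrE ?mulr_ge0 ?(ltW Y0) ?(ltW pn0) ?(ltW N0) //.
by apply: le_trans h3; lra.
Unshelve. all: by end_near. Qed.

End Threshold.

Theorem lemma3p5 (R : realType) (T : finType) (H K : sgraph T)
    (p : nat -> R)
    (d : nat -> measure_display)
    (Omega : forall n, measurableType (d n))
    (P : forall n, probability (Omega n) R)
    (G : forall n, 'I_n -> 'I_n -> {RV (P n) >-> bool}) :
  let v := #|verts H| in
  let e := #|edges H| in
  let vt := #|verts K| in
  let et := #|edges K| in
  let Dt := max_deg K in
  let w := (v - vt)%N in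
  (2 <= v)%N -> connected_graph H -> ~ is_tree H -> is_two_core K H ->
  (forall n, 0 <= p n <= 1) ->
  much_less (fun n => (n%:R * ln n%:R) `^ (- (Dt%:R)^-1)) p ->
  much_less p (fun=> 1) ->
  (forall n, erdos_renyi (p n) (@G n)) ->
  cvg_in_probability0 P (fun n omega =>
    let g := fun i j : 'I_n => G n i j omega in
    sup (range (fun S : {set 'I_n} =>
      (n%:R ^+ v)^-1 *
      `| p n ^- e * (copies H S g)%:R
         - falling (#|S|%:R - vt%:R) w * p n ^- et * (copies K S g)%:R |))).
Proof.
move=> v e vt et Dt w v2 cH ntH core p01 hp _ GER eps eps0.
pose X n (g : 'I_n -> 'I_n -> bool) : R := sup (range (fun S => gap H K (p n) g S)).
pose A n : pred {ffun upair n -> bool} := fun c => eps < `|X n (config_graph c)|.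
pose a n : R := \sum_(c | A n c) weight (p n) c.
have PE n : P n [set omega | eps < `|X n (fun i j => G n i j omega)|] = (a n)%:E.
  rewrite -(prob_config (p01 n) (GER n)); congr (P n _).
  apply/funext => omega; rewrite /= /A; congr (is_true (eps < `|X n _|)).
  by apply/funext => i; apply/funext => j; exact: (config_ofE (GER n)).
suff lim : (fun n => P n [set omega | eps < `|X n (fun i j => G n i j omega)|])
    @ \oo --> 0%E by exact: lim.
rewrite (funext PE); apply: cvg_EFin; first exact: nearW.
apply/cvgrPdist_le => delta delta0.
have T0 : (0 < #|T|)%N by apply: leq_trans (max_card _); exact: ltnW v2.
have [Y [Y0 tail]] := gap_tail cH ntH core T0 eps0 delta0.
have Dt2 := two_core_max_deg cH ntH core.
apply: filterS (threshold_near p01 Dt2 hp Y0) => n [n0 pn0 hD h3 hY].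
rewrite /= sub0r normrN ger0_norm; last first.
  by apply: sumr_ge0 => c _; exact: weight_ge0.
apply: tail => //; first by case/andP: (p01 n).
(* If no [S] exceeds eps, the range is nonempty and bounded by eps, so its supremum is a genuine
   one, lying between 0 and eps. *)
move=> c Ac; apply: contrapT => noS; move: Ac; rewrite /A ltNge => /negP; apply.
have le_eps S : gap H K (p n) (config_graph c) S <= eps.
  by rewrite leNgt; apply/negP => h; apply: noS; exists S.
have gap0 S : 0 <= gap H K (p n) (config_graph c) S.
  by rewrite /gap mulr_ge0 ?invr_ge0 ?exprn_ge0.
have ub : ubound (range (fun S => gap H K (p n) (config_graph c) S)) eps.
  by move=> _ [S _ <-].
rewrite ger0_norm.
  by apply: ge_sup => //; exists (gap H K (p n) (config_graph c) finset.set0), finset.set0.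
apply: (le_trans (gap0 finset.set0)); apply: ub_le_sup; first by exists eps.
by exists finset.set0.
Qed.
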